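(* Let $\gamma=(\gamma_k)_{k=1}^\infty$ be a sequence with $0<\gamma_k<1/4$ for all $k\in\mathbb{N}$ and $\sum_{k=1}^\infty 2^{-k}\log(1/\gamma_k)<\infty$, let $K(\gamma)\subset[0,1]$ be the associated Cantor set and $\rho_{K(\gamma)}$ its equilibrium measure, and let $\delta_m=\gamma_0\gamma_1\cdots\gamma_m$ for $m\in\mathbb{N}_0$, where $\gamma_0:=1$. Let $n\in\mathbb{N}$ with $n>1$ and let $s$ be the integer satisfying $2^{s-1}\leq n<2^s$. Then $$\delta_{s+2}\leq M_n(\rho_{K(\gamma)})\leq\frac{\pi^2}{4}\cdot\delta_{s-2}.$$ In particular, if $\inf_{k}\gamma_k=c>0$, then $$c^2\cdot\delta_s\leq M_n(\rho_{K(\gamma)})\leq\frac{\pi^2}{4c^2}\cdot\delta_s.$$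
   Context: $\mathbb{N}=\{1,2,\dots\}$, $\mathbb{N}_0=\mathbb{N}\cup\{0\}$. The set $K(\gamma)$: given $\gamma$ as in the claim, let $f_1(z):=2z(z-1)/\gamma_1+1$ and $f_n(z):=z^2/(2\gamma_n)+1-1/(2\gamma_n)$ for $n>1$, and let $F_n:=f_n\circ\dots\circ f_1$. Put $E_0:=[0,1]$ and $E_n:=F_n^{-1}([-1,1])$ for $n\in\mathbb{N}$; $E_n$ is a union of $2^n$ disjoint non-degenerate compact intervals in $[0,1]$ and $E_n\subset E_{n-1}$. Then $K(\gamma):=\bigcap_{n=0}^\infty E_n$, a non-polar Cantor set in $[0,1]$ containing $0$ and $1$. $\rho_{K(\gamma)}$ is the equilibrium measure (in the sense of logarithmic potential theory) of $K(\gamma)$; its support is $K(\gamma)$. For a Borel probability measure $\mu$ on $\mathbb{R}$ with infinite compact support, $P_n(\cdot;\mu)$ is the $n$-th monic orthogonal polynomial for $\mu$ (monic of degree $n$, orthogonal in $L_2(\mu)$ to all polynomials of degree less than $n$); its zeros are real and simple. With $Z_n(\mu):=\{x:P_n(x;\mu)=0\}$, for $n>1$ put $$M_n(\mu):=\inf_{\substack{x,x'\in Z_n(\mu)\\ x\neq x'}}|x-x'|.$$ *)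

(* Defs.v *)
From HB Require Import structures.
From mathcomp Require Import all_boot all_order all_algebra.
From mathcomp Require Import all_classical all_reals all_analysis.

Set Implicit Arguments.
Unset Strict Implicit.
Unset Printing Implicit Defensive.

Import Order.TTheory GRing.Theory Num.Theory.
Import numFieldNormedType.Exports.

Local Open Scope classical_set_scope.
Local Open Scope ring_scope.

(* Sequences gamma_1, gamma_2, ... are functions nat -> R whose value at 0 is
   never used. *)

Definition gf (R : realType) (gamma : nat -> R) (n : nat) (z : R) : R :=
  if n == 1%N then 2 * z * (z - 1) / gamma 1%N + 1
  else z ^+ 2 / (2 * gamma n) + 1 - 1 / (2 * gamma n).

Fixpoint gF (R : realType) (gamma : nat -> R) (n : nat) (z : R) : R :=
  if n is m.+1 then gf gamma n (gF gamma m z) else z.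

(* For 0 < gamma_k < 1/4 the preimage of [-1, 1] under gF gamma n in the
   complex plane is real, so the preimage is taken in R. *)
Definition gE (R : realType) (gamma : nat -> R) (n : nat) : set R :=
  if n is 0%N then `[0, 1] else gF gamma n @^-1` `[-1, 1].

Definition gK (R : realType) (gamma : nat -> R) : set R :=
  \bigcap_n gE gamma n.

(* gamma_0 gamma_1 ... gamma_m with gamma_0 = 1. *)
Definition gdelta (R : realType) (gamma : nat -> R) (m : nat) : R :=
  \prod_(1 <= k < m.+1) gamma k.

(* Double integral of log(1 / |x - y|). As lne 0 = -oo, the kernel is +oo on
   the diagonal. *)
Definition log_energy (R : realType)
    (mu : probability (measurableTypeR R) R) : \bar R :=
  (\int[mu]_x \int[mu]_y (- lne `|x - y|%:E))%E.

(* mu minimizes the logarithmic energy among the Borel probability measures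
   carried by K. *)
Definition is_equilibrium_measure (R : realType) (K : set R)
    (mu : probability (measurableTypeR R) R) : Prop :=
  mu K = 1%E /\
  forall nu : probability (measurableTypeR R) R,
    nu K = 1%E -> (log_energy mu <= log_energy nu)%E.

Definition is_monic_orthogonal (R : realType)
    (mu : probability (measurableTypeR R) R) (n : nat) (P : {poly R}) : Prop :=
  [/\ P \is monic, size P = n.+1 &
      forall q : {poly R}, (size q <= n)%N ->
        (\int[mu]_x (P.[x] * q.[x])%:E = 0)%E].

(* Such a polynomial exists and is unique when mu has infinite compact
   support. *)
Definition orthopoly (R : realType) (n : nat)
    (mu : probability (measurableTypeR R) R) : {poly R} :=
  xget 0 [set P | is_monic_orthogonal mu n P].

Definition Zset (R : realType) (n : nat)
    (mu : probability (measurableTypeR R) R) : set R :=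
  [set x | (orthopoly n mu).[x] = 0].

Definition Mgap (R : realType) (n : nat)
    (mu : probability (measurableTypeR R) R) : R :=
  inf [set d | exists x x' : R,
         [/\ Zset n mu x, Zset n mu x', x <> x' & d = `|x - x'|]].

(* Main.v *)
Require Import Defs.
From HB Require Import structures.
From mathcomp Require Import all_boot all_order all_algebra.
From mathcomp Require Import all_classical all_reals all_analysis measurable_realfun.
From mathcomp Require Import lra ring zify.

Set Implicit Arguments.
Unset Strict Implicit.
Unset Printing Implicit Defensive.

Import Order.TTheory GRing.Theory Num.Theory.
Import numFieldNormedType.Exports.

Local Open Scope classical_set_scope.
Local Open Scope ring_scope.

(** Put G_0(x) = 1 - 2x and G_n = F_n for n > 0 ([gorbit]).  Then
    G_(n+1) = (G_n^2 - 1) / (2 gamma_(n+1)) + 1 for every n, and K(gamma) is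
    the set on which all |G_n| are at most 1.  The symmetry G_n -> - G_n
    at every level governs the equilibrium measure rho, and through it the
    orthogonal polynomials.

    _From symmetry to zeros._  Suppose that the integral of G_i p(G_i^2)
    against rho vanishes for all i and all polynomials p
    ([orbit_odd_moment]).  A polynomial of degree < 2^s is a polynomial in
    G_0; splitting it into even and odd parts, rewriting G_0^2 through G_1 and
    going on, one finds that G_s is orthogonal to it ([orbitp_orthogonal]), so
    P_(2^s) is a multiple of G_s.  Gaussian quadrature shows that, for m < n,
    P_n has a zero between any two zeros of P_m and a zero below each of them
    ([root_between], [root_below]).
    - Lower bound: as n < 2^s, two zeros x < x' of P_n enclose a zero z of G_s
      and a zero w of G_(s+1).  Then G_(s+2)(z) > 1 and G_(s+2)(w) < -1, while
      the slope of G_(s+2) is at most 2 / delta_(s+2) as long as its values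
      stay in [-1, 1]; hence x' - x >= delta_(s+2) ([roots_separated]).
    - Upper bound: two zeros r1 < r2 of G_(s-1) lie in the leftmost interval
      of the level set |G_(s-2)| <= 1, whose length is at most
      pi^2/4 delta_(s-2) ([leftmost_roots]).  If n = 2^(s-1) they are zeros of
      P_n, and otherwise P_n has a zero in (r1, r2) and one in [0, r1).

    _Symmetry of the equilibrium measure._  Normalize the logarithmic kernel
    on [-1, 1] as k(u) = - ln (|u| / 2).  If f(x) = (x^2 - 1) / (2g) + 1, then
    k(x - y) + k(x + y) = k(f x - f y) - ln g.  By induction on i, the image
    of rho under G_i has minimal energy among the probability measures on
    G_i(K) ([rho_minimal]): as this set is symmetric, minimality may be
    tested on symmetrized measures, and the identity above compares
    their energies with those one level further.  The induction needs that the
    minimizer is itself symmetric.  The kernel k(x - y) - k(x + y) equals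
    atanh (2xy / (x^2 + y^2)), which expands into products h(x) h(y), with a
    plus sign, of the odd functions h; so the energy of a measure is at least
    its energy against its reflection, with equality only if all odd moments
    vanish ([reflected_energy_gap], [odd_moment_eq0]).

    All this needs a measure of finite energy on K ([cantor_set_finite_energy]).
    It is the law of the point whose itinerary of signs is given by the binary
    digits of a uniform random number; its energy is bounded by the energy
    identity, which turns into the series of 2^-k ln (1 / gamma_k), and by
    Fatou's lemma.  Finite energy also excludes atoms, so that the inner
    product of rho is definite on polynomials. *)

(** * Orthogonal polynomials of a positive functional *)

Section OrthogonalPolynomials.
Variables (R : rcfType) (L : {poly R} -> R).
Hypothesis L_lin : forall a p q, L (a *: p + q) = a * L p + L q.
Hypothesis L_pos : forall p, p != 0 -> (forall x, 0 <= x <= 1 -> 0 <= p.[x]) ->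
  0 < L p.

Definition orthogonal_for (n : nat) (P : {poly R}) : Prop :=
  [/\ P \is monic, size P = n.+1 &
      forall q : {poly R}, (size q <= n)%N -> L (P * q) = 0].

Lemma functional0 : L 0 = 0.
Proof. by have := L_lin (-1) 0 0; rewrite scaler0 addr0 mulN1r addNr. Qed.

Lemma functionalD p q : L (p + q) = L p + L q.
Proof. by have := L_lin 1 p q; rewrite scale1r mul1r. Qed.

Lemma functionalZ a p : L (a *: p) = a * L p.
Proof. by have := L_lin a p 0; rewrite !addr0 functional0 addr0. Qed.

Lemma functionalB p q : L (p - q) = L p - L q.
Proof. by rewrite -scaleN1r functionalD functionalZ mulN1r. Qed.

Lemma functional_sum I (r : seq I) (F : I -> {poly R}) :
  L (\sum_(i <- r) F i) = \sum_(i <- r) L (F i).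
Proof.
by elim: r => [|i r IH]; rewrite ?big_nil ?functional0// !big_cons functionalD IH.
Qed.

Lemma functional_sqr_gt0 p : p != 0 -> 0 < L (p * p).
Proof.
move=> p0; apply: L_pos => [|x _]; first by rewrite mulf_neq0.
by rewrite hornerM -expr2 sqr_ge0.
Qed.

Lemma orthogonal_for_unique n P Q :
  orthogonal_for n P -> orthogonal_for n Q -> P = Q.
Proof.
move=> [mP sP oP] [mQ sQ oQ]; apply/eqP; rewrite -subr_eq0; apply/negPn/negP => D0.
have sD : (size (P - Q)%R <= n)%N.
  apply/leq_sizeP => j; rewrite leq_eqVlt => /orP[/eqP <-|nj].
    move/eqP: mP; move/eqP: mQ; rewrite /lead_coef sP sQ /= => lQ lP.
    by rewrite coefB lQ lP subrr.
  by rewrite coefB !nth_default ?subrr// ?sP ?sQ.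
have := functional_sqr_gt0 D0.
by rewrite [X in L X]mulrBl functionalB oP// oQ// subrr ltxx.
Qed.

(** Gram-Schmidt orthogonalization of the powers of the variable. *)
Lemma orthogonal_for_exists n : exists P, orthogonal_for n P.
Proof.
elim/ltn_ind: n => n IH.
have [F FP] : exists F : nat -> {poly R},
    forall k, (k < n)%N -> orthogonal_for k (F k).
  elim: n IH => [|n IHn] IH; first by exists (fun=> 0).
  have [k kn|F FP] := IHn; first by apply: IH; rewrite ltnS ltnW.
  have [P PP] := IH n (ltnSn n).
  exists (fun k => if k == n then P else F k) => k.
  rewrite ltnS leq_eqVlt => /orP[/eqP ->|kn]; first by rewrite eqxx.
  by rewrite ltn_eqF//; apply: FP.
have nz k : (k < n)%N -> F k != 0.
  by move=> /FP[_ sF _]; rewrite -size_poly_gt0 sF.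
pose S := \sum_(k < n) (L ('X^n * F k) / L (F k * F k)) *: F k.
have sS : (size S <= n)%N.
  apply: (leq_trans (size_sum _ _ _)); apply/bigmax_leqP => k _.
  rewrite (leq_trans (size_scale_leq _ _))//.
  by have [_ -> _] := FP k (ltn_ord k).
have orth k : (k < n)%N -> L (('X^n - S) * F k) = 0.
  move=> kn; rewrite mulrBl functionalB /S mulr_suml functional_sum.
  rewrite (bigD1 (Ordinal kn))//= [X in _ - (_ + X)]big1 ?addr0.
    rewrite -scalerAl functionalZ divfK ?subrr//.
    by rewrite gt_eqF// functional_sqr_gt0 ?nz.
  move=> i ik; rewrite -scalerAl functionalZ.
  have [_ si oi] := FP i (ltn_ord i); have [_ sk ok] := FP k kn.
  have : nat_of_ord i != k by [].
  rewrite neq_ltn => /orP[lik|lki].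
    by rewrite [F i * F k]mulrC (ok (F i)) ?mulr0// si.
  by rewrite (oi (F k)) ?mulr0// sk.
exists ('X^n - S); split.
- by rewrite monicE lead_coefDl ?lead_coefXn// size_polyXn size_polyN ltnS.
- by rewrite size_polyDl ?size_polyXn// size_polyN ltnS.
move=> q sq.
(* Orthogonality to the [F k] spreads to all [q] by removing leading terms. *)
have H k : (k <= n)%N -> forall q : {poly R}, (size q <= k)%N ->
    L (('X^n - S) * q) = 0.
  elim: k => [|k IHk] kn p sp.
    by move: sp; rewrite leqn0 size_poly_eq0 => /eqP ->; rewrite mulr0 functional0.
  have [mF sF _] := FP k kn.
  rewrite -(subrK (p`_k *: F k) p) mulrDr functionalD -scalerAr functionalZ.
  rewrite orth// mulr0 addr0 IHk ?(ltnW kn)//.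
  apply/leq_sizeP => j; rewrite leq_eqVlt => /orP[/eqP <-|kj].
    move/eqP: mF; rewrite /lead_coef sF /= => Fk.
    by rewrite coefB coefZ Fk mulr1 subrr.
  have Fj : (F k)`_j = 0 by rewrite nth_default ?sF.
  by rewrite coefB coefZ (nth_default _ (leq_trans sp kj)) Fj mulr0 subrr.
exact: (H n).
Qed.


(** Collecting the roots of odd multiplicity in [s] leaves a square times a
    factor without real roots, hence of constant sign. *)
Lemma real_poly_factor (p : {poly R}) : p != 0 ->
  exists (s : seq R) (u q : {poly R}),
    [/\ uniq s, p = \prod_(r <- s) ('X - r%:P) * (u * u) * q &
        forall x, ~~ root q x].
Proof.
have [n] := ubnP (size p); elim: n p => // n IH p; rewrite ltnS => sp p0.
case: (pselect (exists x, root p x)) => [[r pr]|nr]; last first.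
  exists [::], 1, p; split=> //; first by rewrite big_nil !mul1r.
  by move=> x; apply/negP => px; apply: nr; exists x.
have [p' pE] := factor_theorem p r pr.
have p'0 : p' != 0 by apply: contra_neq p0 => p'0; rewrite pE p'0 mul0r.
have sp' : (size p' < n)%N.
  by move: sp; rewrite pE size_mul ?polyXsubC_eq0// size_XsubC addn2.
have [s [u [q [us p'E nq]]]] := IH p' sp' p'0.
have [rs|rs] := boolP (r \in s); last first.
  exists (r :: s), u, q; split=> //; first by rewrite /= rs.
  by rewrite big_cons pE p'E; move: ('X - _) => a; ring.
exists (rem r s), (('X - r%:P) * u), q; split=> //; first exact: rem_uniq.
by rewrite pE p'E (perm_big _ (perm_to_rem rs)) big_cons /=; move: ('X - _) (\prod_(_ <- _) _) => a b; ring.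
Qed.

Lemma rootless_sign (q : {poly R}) : (forall x, ~~ root q x) ->
  (forall x, 0 < q.[x]) \/ (forall x, q.[x] < 0).
Proof.
move=> nq.
have ivt (p : {poly R}) x y : (forall x, ~~ root p x) -> 0 < p.[x] -> 0 < p.[y].
  move=> np px; rewrite ltNge; apply/negP => py.
  have [xy|/ltW xy] := leP x y.
    have [|z _ /rootP zr] := @poly_ivt R (- p) x y xy.
      by rewrite !hornerN oppr_le0 oppr_ge0 ltW.
    by have := np z; rewrite /root -[p]opprK hornerN zr oppr0 eqxx.
  have [|z _ zr] := @poly_ivt R p y x xy; first by rewrite py ltW.
  by have := np z; rewrite zr.
have := nq 0; rewrite /root neq_lt => /orP[q0|q0]; [right|left] => x.
  rewrite -oppr_gt0 -hornerN; apply: (ivt (- q) 0); rewrite ?hornerN ?oppr_gt0//.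
  by move=> y; rewrite rootN.
exact: (ivt q 0).
Qed.

(** If [T] collects the roots of odd multiplicity, then [P * T] has constant
    sign, so [L (P * T)] cannot vanish; orthogonality then forces [T] to have
    full degree. *)
Lemma orthogonal_for_roots n P : orthogonal_for n P ->
  exists s : seq R, [/\ uniq s, size s = n & P = \prod_(r <- s) ('X - r%:P)].
Proof.
move=> [mP sP oP]; have P0 : P != 0 by rewrite monic_neq0.
have [s [u [q [us PE nq]]]] := real_poly_factor P0.
set T := \prod_(r <- s) ('X - r%:P) in PE.
have sT : size T = (size s).+1 by rewrite size_prod_XsubC.
have T0 : T != 0 by rewrite -size_poly_gt0 sT.
have PT : L (P * T) != 0.
  have u0 : u != 0 by apply: contra_neq P0 => u0; rewrite PE u0 !(mul0r, mulr0).
  have [qp|qn] := rootless_sign nq.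
    rewrite gt_eqF//; apply: L_pos => [|x _]; first by rewrite mulf_neq0.
    have -> : (P * T).[x] = (T.[x] * u.[x]) ^+ 2 * q.[x].
      by rewrite PE !hornerM; ring.
    by rewrite mulr_ge0 ?sqr_ge0// ltW.
  rewrite -oppr_eq0 -mulN1r -functionalZ gt_eqF//; apply: L_pos => [|x _].
    by rewrite scaler_eq0 negb_or mulf_neq0// oppr_eq0 oner_eq0.
  have -> : (-1 *: (P * T)).[x] = (T.[x] * u.[x]) ^+ 2 * - q.[x].
    by rewrite PE hornerZ !hornerM; ring.
  by rewrite mulr_ge0 ?sqr_ge0// oppr_ge0 ltW.
have sn : (n <= size s)%N.
  rewrite leqNgt; apply/negP => sn; move/eqP: PT; apply; apply: oP.
  by rewrite sT.
have TP : T %| P by rewrite PE -mulrA dvdp_mulr.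
have := dvdp_leq P0 TP; rewrite sT sP ltnS => sn'.
have ssn : size s = n by apply/eqP; rewrite eqn_leq sn' sn.
exists s; split=> //; apply/eqP; rewrite -/T -eqp_monic ?monic_prod_XsubC//.
by rewrite eqp_sym -dvdp_size_eqp// sT sP ssn.
Qed.

(** Such an [f] is a multiple of [P] whose cofactor has degree less than [n].
    *)
Lemma orthogonal_vanish n P (s : seq R) (f : {poly R}) : orthogonal_for n P ->
  uniq s -> P = \prod_(r <- s) ('X - r%:P) ->
  (size f <= n + n)%N -> (forall x, x \in s -> f.[x] = 0) -> L f = 0.
Proof.
move=> [mP sP oP] us PE sf f0.
have Pf : P %| f.
  rewrite PE; apply: uniq_roots_dvdp; last by rewrite uniq_rootsE.
  by apply/allP => x /f0 /eqP.
rewrite -(divpK Pf) mulrC; apply: oP.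
by rewrite size_divp ?monic_neq0// sP /= leq_subLR.
Qed.

(** Gaussian quadrature in disguise: [f] and the combination of the squared
    Lagrange polynomials with the values of [f] agree at the nodes, so [L f]
    is a combination of these values with positive weights. *)
Lemma quadrature_zero n P (s : seq R) (f : {poly R}) : orthogonal_for n P ->
  uniq s -> P = \prod_(r <- s) ('X - r%:P) ->
  (size f <= n + n)%N -> L f = 0 -> (forall x, x \in s -> 0 <= f.[x]) ->
  forall x, x \in s -> f.[x] = 0.
Proof.
move=> oP us PE sf Lf fs.
have ss : size s = n.
  by case: oP => _ + _; rewrite PE size_prod_XsubC => -[].
pose l x : {poly R} := \prod_(r <- rem x s) ('X - r%:P).
have lE x y : y \in s -> y != x -> (l x).[y] = 0.
  move=> ys yx; apply/rootP; rewrite root_prod_XsubC.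
  by rewrite mem_rem_uniq// inE yx.
have lx x : x \in s -> (l x).[x] != 0.
  by move=> xs; rewrite -[_ == _]/(root _ _) root_prod_XsubC mem_rem_uniq// inE eqxx.
have sl x : x \in s -> size (l x) = n.
  move=> xs; rewrite size_prod_XsubC size_rem// ss prednK// -ss.
  by case: (s) xs.
pose d x := f.[x] / (l x).[x] ^+ 2.
pose g := f - \sum_(x <- s) d x *: (l x * l x).
have sg : (size g <= n + n)%N.
  rewrite (leq_trans (size_polyD _ _))// geq_max sf size_polyN.
  rewrite big_seq; apply: (big_ind (fun p : {poly R} => size p <= n + n)%N).
  - by rewrite size_poly0.
  - by move=> p q ps qs; rewrite (leq_trans (size_polyD _ _))// geq_max ps qs.
  move=> x xs; rewrite (leq_trans (size_scale_leq _ _))//.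
  by rewrite (leq_trans (size_polyMleq _ _))// sl// leq_pred.
have g0 : L g = 0.
  apply: (orthogonal_vanish oP us PE sg) => x xs.
  rewrite /g hornerD hornerN horner_sum (big_rem x)//= big_seq big1.
    by rewrite hornerZ hornerM -expr2 /d divfK ?addr0 ?subrr// expf_neq0// lx.
  move=> y ys; rewrite hornerZ hornerM lE ?mulr0//.
  apply/negP => /eqP xy; move: ys.
  by rewrite -xy mem_rem_uniq// inE eqxx.
have dge x : x \in s -> 0 <= d x * L (l x * l x).
  move=> xs; have := fs x xs => fx; rewrite mulr_ge0//.
    by rewrite divr_ge0// sqr_ge0.
  by rewrite ltW// functional_sqr_gt0// -size_poly_gt0 sl// -ss; case: (s) xs.
have : \sum_(x <- s) d x * L (l x * l x) = 0.
  move: g0; rewrite functionalB Lf functional_sum sub0r => /eqP.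
  rewrite oppr_eq0 => /eqP S0; rewrite -[RHS]S0; apply: eq_bigr => x _; by rewrite functionalZ.
move=> /eqP; rewrite big_seq psumr_eq0// => /allP H x xs.
have /implyP/(_ xs) := H x xs.
rewrite mulf_eq0 => /orP[|/eqP L0]; last first.
  suff /functional_sqr_gt0 : l x != 0 by rewrite L0 ltxx.
  by rewrite -size_poly_gt0 sl// -ss; case: (s) xs.
by rewrite mulf_eq0 invr_eq0 sqrf_eq0 (negPf (lx _ xs)) orbF => /eqP.
Qed.

(** With [h] the cofactor of [D] in [P], orthogonality gives [L (P * h) = 0],
    while [(P * h) * D = P ^+ 2]. If [D] were nonnegative at all nodes of [Q],
    quadrature would make all these [n] nodes roots of [P], whose degree is
    only [m]. *)
Lemma root_where_divisor_negative m n P Q (D : {poly R}) : (m < n)%N ->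
  orthogonal_for m P -> orthogonal_for n Q -> D %| P -> (1 < size D)%N ->
  exists x, root Q x /\ D.[x] < 0.
Proof.
move=> mn oP oQ DP sD.
have [s [us ss QE]] := orthogonal_for_roots oQ.
apply: contrapT => H.
have Dge x : x \in s -> 0 <= D.[x].
  move=> xs; rewrite leNgt; apply/negP => Dx; apply: H; exists x.
  by rewrite QE root_prod_XsubC xs.
case: (oP) => mP sP orthP.
have P0 : P != 0 by rewrite monic_neq0.
pose h := P %/ D; have hD : h * D = P by rewrite divpK.
have D0 : D != 0 by rewrite -size_poly_gt0 ltnW.
have sh : (size h <= m)%N.
  by rewrite size_divp// sP; move: sD; case: (size D) => // -[]// k _; rewrite subSS leq_subr.
have PhE x : (P * h).[x] * D.[x] = P.[x] ^+ 2 by rewrite -hD !hornerM; ring.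
have L0 : L (P * h) = 0 by apply: orthP.
have Phge x : x \in s -> 0 <= (P * h).[x].
  move=> xs; have := Dge x xs; rewrite le_eqVlt => /orP[/eqP D0x|Dx].
    by rewrite hornerM -[in P.[x]]hD hornerM -D0x mulr0 mul0r.
  by rewrite -(pmulr_lge0 _ Dx) PhE sqr_ge0.
have sPh : (size (P * h)%R <= n + n)%N.
  rewrite (leq_trans (size_polyMleq _ _))// sP addSn/=.
  by rewrite (leq_trans (leq_add (leqnn m) sh))// leq_add// ltnW.
have Ph0 := quadrature_zero oQ us QE sPh L0 Phge.
have : (size s < size P)%N.
  apply: max_poly_roots => //; apply/allP => x xs; apply/rootP.
  by apply/eqP; rewrite -sqrf_eq0 -PhE Ph0// mul0r.
by rewrite ss sP ltnS leqNgt mn.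
Qed.

Lemma root_between m n P Q a b : (m < n)%N ->
  orthogonal_for m P -> orthogonal_for n Q -> root P a -> root P b -> a < b ->
  exists x, root Q x /\ a < x < b.
Proof.
move=> mn oP oQ Pa Pb ab.
have [||x [Qx]] := root_where_divisor_negative (D := ('X - a%:P) * ('X - b%:P)) mn oP oQ.
- have := @uniq_roots_dvdp R P [:: a; b].
  rewrite uniq_rootsE big_cons big_seq1 /= Pa Pb inE (lt_eqF ab); exact.
- by rewrite size_mul ?polyXsubC_eq0// !size_XsubC.
rewrite hornerM !hornerXsubC => xab; exists x; split=> //.
by apply/andP; split; rewrite ltNge; apply/negP => ?; move: xab; apply/negP; rewrite -leNgt; nra.
Qed.

Lemma root_below m n P Q a : (m < n)%N ->
  orthogonal_for m P -> orthogonal_for n Q -> root P a ->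
  exists x, root Q x /\ x < a.
Proof.
move=> mn oP oQ Pa.
have [||x [Qx]] := root_where_divisor_negative (D := 'X - a%:P) mn oP oQ.
- by rewrite dvdp_XsubCl.
- by rewrite size_XsubC.
by rewrite hornerXsubC subr_lt0 => xa; exists x.
Qed.

(** At a negative root the polynomial [P ^+ 2 / (X - x)] would be positive on
    the unit interval, but orthogonality makes [L] vanish on it. *)
Lemma orthogonal_root_ge0 n P x : orthogonal_for n P -> root P x -> 0 <= x.
Proof.
move=> [mP sP oP] Px; rewrite leNgt; apply/negP => x0.
have P0 : P != 0 by rewrite monic_neq0.
have [h hE] := factor_theorem P x Px.
have h0 : h != 0 by apply: contra_neq P0 => h0; rewrite hE h0 mul0r.
have : 0 < L (P * h).
  apply: L_pos => [|y /andP[y0 _]]; first by rewrite mulf_neq0.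
  rewrite hE !hornerM hornerXsubC mulrAC -expr2 mulr_ge0 ?sqr_ge0// subr_ge0.
  by rewrite (le_trans (ltW x0)).
rewrite oP ?ltxx// -ltnS -sP hE size_mul ?polyXsubC_eq0// size_XsubC addn2.
by rewrite ltnS.
Qed.

End OrthogonalPolynomials.

(** * The quadratic dynamics and its intervals *)

(** The map [gf gamma n] for [n > 1], with parameter [g = gamma n]. *)
Definition quad (R : realType) (g z : R) : R := (z ^+ 2 - 1) / (2 * g) + 1.

(** Starting from the affine map [1 - 2 x] in place of the identity makes the
    recursion uniform: the same quadratic map is applied at every level, the
    first one included. *)
Definition gorbit (R : realType) (gamma : nat -> R) (n : nat) (x : R) : R :=
  if n is 0%N then 1 - 2 * x else gF gamma n x.

Fixpoint gorbitp (R : realType) (gamma : nat -> R) (n : nat) : {poly R} :=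
  if n is m.+1 then
    (2 * gamma n)^-1 *: (gorbitp gamma m ^+ 2 - 1) + 1
  else 1 - 2 *: 'X.

Section Dynamics.
Variables (R : realType) (gamma : nat -> R).
Hypothesis gamma_bnd : forall k, (0 < k)%N -> 0 < gamma k < 1 / 4.

Lemma gamma_gt0 k : (0 < k)%N -> 0 < gamma k.
Proof. by move/gamma_bnd/andP => []. Qed.

Lemma gammaS_gt0 k : 0 < gamma k.+1.
Proof. exact: gamma_gt0. Qed.

Lemma gammaS_lt k : gamma k.+1 < 1 / 4.
Proof. by have /andP[] := gamma_bnd (ltn0Sn k). Qed.

Lemma orbitS n x : gorbit gamma n.+1 x = quad (gamma n.+1) (gorbit gamma n x).
Proof.
have g0 := gammaS_gt0 n; rewrite /gorbit /quad /= /gf.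
by case: n g0 => [|n] g0; rewrite ?eqxx /=; field; rewrite gt_eqF.
Qed.

Lemma orbitpE n x : (gorbitp gamma n).[x] = gorbit gamma n x.
Proof.
elim: n => [|n IH].
  by rewrite /= hornerD hornerN hornerZ hornerX hornerC.
rewrite orbitS /= hornerD hornerZ hornerD hornerN horner_exp !hornerC IH /quad.
by rewrite mulrC.
Qed.

Lemma size_orbitp n : size (gorbitp gamma n) = (2 ^ n).+1.
Proof.
elim: n => [|n IH] /=.
  have s2X : size (- (2 *: 'X) : {poly R}) = 2%N.
    by rewrite size_polyN size_scale ?size_polyX ?pnatr_eq0.
  by rewrite addrC size_polyDl s2X ?size_poly1.
have g0 : (2 * gamma n.+1)^-1 != 0.
  by rewrite invr_eq0 mulf_neq0 ?pnatr_eq0// gt_eqF// gammaS_gt0.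
have n0 : gorbitp gamma n != 0 by rewrite -size_poly_gt0 IH.
have s2 : size (gorbitp gamma n ^+ 2) = (2 ^ n.+1).+1.
  by rewrite expr2 size_mul// IH expnS; lia.
have s2B : size (gorbitp gamma n ^+ 2 - 1) = (2 ^ n.+1).+1.
  by rewrite size_polyDl s2// size_polyN size_poly1 ltnS expn_gt0.
by rewrite size_polyDl size_scale ?s2B// size_poly1 ltnS expn_gt0.
Qed.

Lemma orbitp_sqr n :
  gorbitp gamma n ^+ 2 = (2 * gamma n.+1) *: (gorbitp gamma n.+1 - 1) + 1.
Proof.
have g0 : 2 * gamma n.+1 != 0.
  by rewrite mulf_neq0 ?pnatr_eq0// gt_eqF// gammaS_gt0.
by rewrite /= addrK scalerA divff// scale1r subrK.
Qed.

Lemma orbitp_even i m :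
  exists c : {poly R}, gorbitp gamma (i + m.+1) = c \Po gorbitp gamma i ^+ 2.
Proof.
elim: m => [|m [c IH]].
  exists ((2 * gamma i.+1)^-1 *: ('X - 1) + 1).
  by rewrite addn1 /= comp_polyD comp_polyZ comp_polyB comp_polyX comp_polyC.
exists ((2 * gamma (i + m.+1).+1)^-1 *: (c ^+ 2 - 1) + 1).
rewrite addnS /= IH comp_polyD comp_polyZ comp_polyB comp_polyC.
by rewrite rmorphXn.
Qed.

Lemma orbit_contract n x : `|gorbit gamma n.+1 x| <= 1 -> `|gorbit gamma n x| <= 1.
Proof.
rewrite orbitS /quad !ler_norml => /andP[_ h].
have g0 := gammaS_gt0 n.
have : (gorbit gamma n x ^+ 2 - 1) / (2 * gamma n.+1) <= 0 by lra.
rewrite pmulr_lle0 ?invr_gt0 ?mulr_gt0// => h'.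
by apply/andP; split; nra.
Qed.

Lemma gdeltaS n : gdelta gamma n.+1 = gdelta gamma n * gamma n.+1.
Proof. by rewrite /gdelta big_nat_recr. Qed.

Lemma gdelta_gt0 n : 0 < gdelta gamma n.
Proof.
elim: n => [|n IH]; first by rewrite /gdelta big_geq.
by rewrite gdeltaS mulr_gt0// gammaS_gt0.
Qed.

(** Each step multiplies differences by [(A + B) / (2 g)], which is at most [1
    / g] in absolute value as long as both orbits stay in [-1, 1]. *)
Lemma orbit_lipschitz n a b :
  `|gorbit gamma n a| <= 1 -> `|gorbit gamma n b| <= 1 ->
  gdelta gamma n * `|gorbit gamma n a - gorbit gamma n b| <= 2 * `|a - b|.
Proof.
elim: n => [|n IH] ha hb.
  rewrite /gdelta big_geq// mul1r /gorbit.
  have -> : 1 - 2 * a - (1 - 2 * b) = 2 * (b - a) by ring.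
  by rewrite normrM gtr0_norm// distrC.
have ha' := orbit_contract ha; have hb' := orbit_contract hb.
apply: le_trans (IH ha' hb'); rewrite gdeltaS -mulrA ler_wpM2l ?(ltW (gdelta_gt0 n))//.
have g0 := gammaS_gt0 n; rewrite !orbitS /quad.
set A := gorbit gamma n a in ha' *; set B := gorbit gamma n b in hb' *.
have -> : (A ^+ 2 - 1) / (2 * gamma n.+1) + 1 - ((B ^+ 2 - 1) / (2 * gamma n.+1) + 1)
  = (A + B) / 2 * (A - B) / gamma n.+1 by field; rewrite gt_eqF.
rewrite normrM normfV (gtr0_norm g0) mulrC divfK ?gt_eqF// normrM.
rewrite ler_piMl// normrM normfV (@gtr0_norm _ 2)// ler_pdivrMr// mul1r.
by rewrite (le_trans (ler_normD _ _))//; lra.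
Qed.

(** The value is [1 - 1 / (2 g)], and [g < 1 / 4]. *)
Lemma orbit_zero_next n z : gorbit gamma n z = 0 -> gorbit gamma n.+1 z < -1.
Proof.
move=> z0; rewrite orbitS z0 /quad.
have g0 := gammaS_gt0 n; have g4 := gammaS_lt n.
rewrite expr0n /= sub0r mulN1r.
suff : 2 < (2 * gamma n.+1)^-1 by lra.
rewrite -[2 in X in X < _]invrK ltf_pV2 ?posrE ?invr_gt0 ?mulr_gt0//; lra.
Qed.

Lemma orbit_escape n z : gorbit gamma n z < -1 -> 1 < gorbit gamma n.+1 z.
Proof.
move=> h; rewrite orbitS /quad ltrDr divr_gt0 ?mulr_gt0 ?gammaS_gt0//.
by rewrite subr_gt0; nra.
Qed.

Lemma orbit_crossing n z w : 1 <= gorbit gamma n z -> gorbit gamma n w <= -1 ->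
  gdelta gamma n <= `|z - w|.
Proof.
move=> hz hw.
have ivt v : -1 <= v <= 1 -> exists2 c, Num.min z w <= c <= Num.max z w &
    gorbit gamma n c = v.
  move=> /andP[v1 v2].
  have [zw|wz] := leP z w.
    have [|c cI /rootP] := @poly_ivt R (v%:P - gorbitp gamma n) z w zw.
      by apply/andP; split; rewrite !hornerE !orbitpE; lra.
    rewrite hornerD hornerN hornerC orbitpE => /eqP; rewrite subr_eq0 => /eqP vE.
    by exists c.
  have [|c cI /rootP] := @poly_ivt R (gorbitp gamma n - v%:P) w z (ltW wz).
    by rewrite !hornerD !hornerN !hornerC !orbitpE subr_le0 subr_ge0; lra.
  rewrite hornerD hornerN hornerC orbitpE => /eqP; rewrite subr_eq0 => /eqP vE.
  by exists c.
have [|c /andP[c1 c2] cE] := ivt 1; first by lra.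
have [|d /andP[d1 d2] dE] := ivt (-1); first by lra.
have := @orbit_lipschitz n c d; rewrite cE dE normrN normr1 => /(_ (lexx _) (lexx _)).
have -> : (1 - -1 : R) = 2 by ring.
rewrite (@gtr0_norm _ 2)// [_ * 2]mulrC ler_pM2l// => /le_trans; apply.
have : Num.max z w - Num.min z w = `|z - w| by rewrite maxr_absE minr_absE; field.
by rewrite ler_norml => <-; apply/andP; split; lra.
Qed.

(** The zero [z] has escaped above 1 at level [n + 2], while [w] is still
    below -1 there. *)
Lemma roots_separated n z w x x' : gorbit gamma n z = 0 -> gorbit gamma n.+1 w = 0 ->
  x < z < x' -> x < w < x' -> gdelta gamma n.+2 <= x' - x.
Proof.
move=> z0 w0 zx wx.
have hz := orbit_escape (orbit_zero_next z0).
have hw := orbit_zero_next w0.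
apply: le_trans (orbit_crossing (ltW hz) (ltW hw)) _.
by rewrite ler_norml; apply/andP; split; lra.
Qed.

Lemma sin_le_id (x : R) : 0 <= x -> sin x <= x.
Proof.
move=> x0.
have [|c _] := @MVT_segment R sin cos 0 x x0 (fun y _ => is_derive_sin y).
  by apply: continuous_subspaceT => y; exact: continuous_sin.
rewrite sin0 !subr0 => ->; rewrite ler_piMl// cos_le1//.
Qed.

(** Backward orbit along the branch next to 0. With [y = (1 - G) / 2] the step
    reads [y' (1 - y') = g y]. For [g = 1 / 4] it is solved by [y = sin t ^+
    2], [y' = sin (t / 2) ^+ 2]; comparison with this solution bounds the
    product of the factors [1 / (1 - y')] that separates the point from
    [delta_n y]. *)
Lemma leftmost_preimage n (y t : R) : 0 < t <= pi / 2 -> 0 <= y <= sin t ^+ 2 ->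
  exists x, [/\ (1 - gorbit gamma n x) / 2 = y, 0 <= x &
    x * sin t ^+ 2 <= y * gdelta gamma n * 4 ^+ n * sin (t / 2 ^+ n) ^+ 2].
Proof.
elim: n y t => [|n IH] y t /andP[t0 tpi] /andP[y0 yt].
  exists y; split=> //; first by rewrite /gorbit; field.
  by rewrite expr0 divr1 /gdelta big_geq// !mulr1.
have g0 := gammaS_gt0 n; have g4 := gammaS_lt n.
set g := gamma n.+1 in g0 g4 *.
have pi0 := @pi_gt0 R.
have c0 : 0 < cos (t / 2) by apply: cos_gt0_pihalf; apply/andP; split; lra.
have s0 : 0 < sin (t / 2) by apply: sin_gt0_pihalf; apply/andP; split; lra.
have tE : t = (t / 2) *+ 2 by rewrite -mulr_natr divfK.
have stE : sin t = 2 * (cos (t / 2) * sin (t / 2)).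
  by rewrite {1}tE sin_mulr2n -mulr_natl.
have cs := cos2Dsin2 (t / 2).
have sc : sin (t / 2) <= cos (t / 2).
  have : 0 <= cos t by apply: cos_ge0_pihalf; apply/andP; split; lra.
  by rewrite {1}tE cos_mulr2n -mulr_natl; nra.
have yle1 : y <= 1 by apply: le_trans yt _; have := sin_le1 t; have := sin_geN1 t; nra.
have d0 : 0 <= 1 - 4 * g * y by nra.
pose r := Num.sqrt (1 - 4 * g * y).
have r0 : 0 <= r by rewrite sqrtr_ge0.
have r2 : r ^+ 2 = 1 - 4 * g * y by rewrite sqr_sqrtr.
pose y' := (1 - r) / 2.
have y'E : y' * (1 - y') = g * y.
  by apply: (@mulfI _ 4); rewrite // /y'; nra.
have gy0 : 0 <= g * y by rewrite mulr_ge0 ?(ltW g0).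
have r1 : r <= 1 by nra.
have y'0 : 0 <= y' by rewrite /y'; lra.
have y'2 : y' <= 1 / 2 by rewrite /y'; lra.
set S := sin (t / 2) in s0 sc cs stE *; set C := cos (t / 2) in c0 sc cs stE *.
have y'S : y' <= S ^+ 2.
  rewrite leNgt; apply/negP => h.
  have : g * y <= S ^+ 2 * C ^+ 2.
    apply: (@le_trans _ _ (1/4 * sin t ^+ 2)); last by rewrite stE; nra.
    by apply: ler_pM => //; lra.
  rewrite -y'E.
  have S2 : S ^+ 2 <= 1 / 2 by nra.
  have -> : C ^+ 2 = 1 - S ^+ 2 by lra.
  nra.
have [||x [xE x0 xle]] := IH y' (t / 2).
- by apply/andP; split; lra.
- by rewrite y'0 y'S.
exists x; split=> //.
  rewrite orbitS /quad -/g.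
  have -> : gorbit gamma n x = 1 - 2 * y' by move: xE; lra.
  have -> : (1 - 2 * y') ^+ 2 - 1 = - 4 * (y' * (1 - y')) by ring.
  by rewrite y'E; field; rewrite gt_eqF.
have -> : t / 2 ^+ n.+1 = t / 2 / 2 ^+ n.
  by rewrite exprS invfM mulrA.
rewrite stE -/S -/C gdeltaS -/g [4 ^+ n.+1]exprS.
set K := sin (t / 2 / 2 ^+ n) in xle *; rewrite -/S in xle.
set D := gdelta gamma n in xle *.
have D0 : 0 <= D by rewrite ltW// gdelta_gt0.
have E0 : 0 <= 4 ^+ n * K ^+ 2 by apply: mulr_ge0; [apply: exprn_ge0|exact: sqr_ge0].
have step : y' * C ^+ 2 <= g * y.
  rewrite -y'E ler_wpM2l//; lra.
have -> : x * (2 * (C * S)) ^+ 2 = 4 * C ^+ 2 * (x * S ^+ 2) by ring.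
have h1 : 4 * C ^+ 2 * (x * S ^+ 2) <= 4 * C ^+ 2 * (y' * D * 4 ^+ n * K ^+ 2).
  by rewrite ler_wpM2l// mulr_ge0// sqr_ge0.
apply: le_trans h1 _.
have -> : 4 * C ^+ 2 * (y' * D * 4 ^+ n * K ^+ 2) = (y' * C ^+ 2) * (4 * D * (4 ^+ n * K ^+ 2)) by ring.
have -> : y * (D * g) * (4 * 4 ^+ n) * K ^+ 2 = (g * y) * (4 * D * (4 ^+ n * K ^+ 2)) by ring.
apply: ler_wpM2r => //; apply: mulr_ge0 => //; exact: mulr_ge0.
Qed.

(** The previous lemma at [t = pi / 2], together with [sin h <= h] for [h = pi
    / 2 ^+ n.+1]. *)
Lemma leftmost_interval n (v : R) : -1 <= v <= 1 ->
  exists x, [/\ gorbit gamma n x = v, 0 <= x & x <= pi ^+ 2 / 4 * gdelta gamma n].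
Proof.
move=> v1.
have pi0 := @pi_gt0 R.
have [||x [xE x0 xle]] := @leftmost_preimage n ((1 - v) / 2) (pi / 2).
- by apply/andP; split; lra.
- by rewrite sin_pihalf expr1n; apply/andP; split; lra.
exists x; split=> //; first by move: xE; lra.
move: xle; rewrite sin_pihalf expr1n mulr1 => /le_trans; apply.
have D0 := ltW (gdelta_gt0 n); set D := gdelta gamma n in D0 *.
pose h : R := pi / 2 / 2 ^+ n.
have h0 : 0 <= h by rewrite divr_ge0// ?exprn_ge0// ltW// divr_gt0.
have sh : sin h ^+ 2 <= h ^+ 2.
  have s0 : 0 <= sin h.
    apply: sin_ge0_pi; rewrite h0 /h ler_pdivrMr ?exprn_gt0//=.
    apply: (@le_trans _ _ (pi * 1)); first lra.
    by rewrite ler_pM2l// exprn_ege1// ler1n.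
  by rewrite ler_sqr ?nnegrE// sin_le_id.
have -> : pi ^+ 2 / 4 * D = D * (4 ^+ n * h ^+ 2).
  rewrite /h !expr_div_n -exprM mulnC exprM.
  have -> : (2 ^+ 2 : R) = 4 by ring.
  field; rewrite expf_neq0//.
have -> : (1 - v) / 2 * D * 4 ^+ n * sin h ^+ 2 = (1 - v) / 2 * (D * (4 ^+ n * sin h ^+ 2)) by ring.
apply: (@le_trans _ _ (1 * (D * (4 ^+ n * sin h ^+ 2)))).
  apply: ler_wpM2r; last lra.
  by apply: mulr_ge0 => //; apply: mulr_ge0; [apply: exprn_ge0|apply: sqr_ge0].
by rewrite mul1r ler_wpM2l// ler_wpM2l// exprn_ge0.
Qed.

Lemma leftmost_roots n : exists r1 r2 : R,
  [/\ gorbit gamma n.+1 r1 = 0, gorbit gamma n.+1 r2 = 0, 0 <= r1, r1 < r2 &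
      r2 <= pi ^+ 2 / 4 * gdelta gamma n].
Proof.
have g0 := gammaS_gt0 n; have g4 := gammaS_lt n.
pose v := Num.sqrt (1 - 2 * gamma n.+1).
have d0 : 0 < 1 - 2 * gamma n.+1 by lra.
have v0 : 0 < v by rewrite sqrtr_gt0.
have v2 : v ^+ 2 = 1 - 2 * gamma n.+1 by rewrite sqr_sqrtr// ltW.
have v1 : v <= 1 by nra.
have qv w : w ^+ 2 = v ^+ 2 -> quad (gamma n.+1) w = 0.
  by move=> wv; rewrite /quad wv v2; field; rewrite gt_eqF.
have [|a [aE a0 ale]] := @leftmost_interval n v; first by apply/andP; split; lra.
have [|b [bE b0 ble]] := @leftmost_interval n (- v); first by apply/andP; split; lra.
have az : gorbit gamma n.+1 a = 0 by rewrite orbitS aE qv.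
have bz : gorbit gamma n.+1 b = 0 by rewrite orbitS bE qv// sqrrN.
have : a != b by apply/eqP => ab; move: aE; rewrite ab bE; lra.
by rewrite neq_lt => /orP[ab|ba]; [exists a, b|exists b, a].
Qed.

(** A polynomial in [G_i] is [a(G_i ^ 2) + b(G_i ^ 2) G_i]. The second part is
    orthogonal to [G_s], itself a polynomial in [G_i ^ 2], by oddness; as [G_i
    ^ 2] is affine in [G_(i+1)], the first part is a polynomial of half the
    degree in [G_(i+1)]. *)
Lemma orbitp_orthogonal (L : {poly R} -> R) :
  (forall a p q, L (a *: p + q) = a * L p + L q) ->
  (forall i (b : {poly R}), L (gorbitp gamma i * (b \Po gorbitp gamma i ^+ 2)) = 0) ->
  forall s, orthogonal_for L (2 ^ s)
    ((lead_coef (gorbitp gamma s))^-1 *: gorbitp gamma s).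
Proof.
move=> Llin Lodd s.
have H m i : (i + m)%N = s -> forall r : {poly R}, (size r <= 2 ^ m)%N ->
    L (gorbitp gamma s * (r \Po gorbitp gamma i)) = 0.
  elim: m i => [|m IH] i ims r sr.
    rewrite addn0 in ims; subst i.
    have [c ->] : exists c, r = c%:P by exists r`_0; apply: size1_polyC.
    by rewrite comp_polyC -(comp_polyC c (gorbitp gamma s ^+ 2)) Lodd.
  have sodd : (size (odd_poly r) <= 2 ^ m)%N.
    by rewrite (leq_trans (size_odd_poly _))// leq_half_double -mul2n -expnS ltnW.
  have seven : (size (even_poly r) <= 2 ^ m)%N.
    by rewrite (leq_trans (size_even_poly _))// leq_uphalf_double -mul2n -expnS.
  have -> : r \Po gorbitp gamma i = (even_poly r \Po gorbitp gamma i ^+ 2) +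
      (odd_poly r \Po gorbitp gamma i ^+ 2) * gorbitp gamma i.
    rewrite -{1}[r]poly_even_odd comp_polyD comp_polyM comp_polyX.
    by rewrite -!comp_polyA comp_Xn_poly.
  rewrite mulrDr (functionalD Llin).
  have -> : L (gorbitp gamma s * ((odd_poly r \Po gorbitp gamma i ^+ 2) * gorbitp gamma i)) = 0.
    have [c cE] := orbitp_even i m.
    rewrite -ims cE mulrA -comp_polyM mulrC.
    exact: Lodd.
  rewrite addr0 orbitp_sqr.
  pose a : {poly R} := (2 * gamma i.+1) *: ('X - 1) + 1.
  have -> : (2 * gamma i.+1) *: (gorbitp gamma i.+1 - 1) + 1 = a \Po gorbitp gamma i.+1.
    by rewrite /a comp_polyD comp_polyZ comp_polyB comp_polyX comp_polyC.
  rewrite comp_polyA IH ?addSnnS//.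
  have g0 : 2 * gamma i.+1 != 0.
    by rewrite mulf_neq0 ?pnatr_eq0// gt_eqF// gammaS_gt0.
  have sa : size a = 2%N.
    have s1 : size ((2 * gamma i.+1) *: ('X - 1 : {poly R})) = 2%N.
      by rewrite size_scale// size_XsubC.
    by rewrite /a size_polyDl s1 ?size_poly1.
  by rewrite size_comp_poly2.
have G0 : gorbitp gamma s != 0 by rewrite -size_poly_gt0 size_orbitp.
have l0 : (lead_coef (gorbitp gamma s))^-1 != 0 by rewrite invr_eq0 lead_coef_eq0.
split.
- by rewrite monicE lead_coefZ mulVf// lead_coef_eq0.
- by rewrite size_scale// size_orbitp.
move=> q sq; rewrite -scalerAl (functionalZ Llin).
pose b : {poly R} := 2^-1 *: (1 - 'X).
have -> : q = (q \Po b) \Po gorbitp gamma 0.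
  rewrite -comp_polyA /b comp_polyZ comp_polyB comp_polyX comp_polyC /=.
  rewrite opprB addrC subrK scalerA mulVf ?pnatr_eq0// scale1r.
  by rewrite comp_polyXr.
have sb : size b = 2%N.
  by rewrite /b size_scale ?invr_eq0 ?pnatr_eq0// -opprB size_polyN size_XsubC.
by rewrite (H s 0%N) ?mulr0// size_comp_poly2.
Qed.

End Dynamics.

(** * The logarithmic kernel and energies *)

Section LogarithmicKernel.
Variable R : realType.

(** The kernel [- ln (|u| / 2)], truncated at 0 so as to be nonnegative
    everywhere; on differences of points of [-1, 1] the truncation is
    inactive. *)
Definition logk (u : R) : \bar R :=
  if u == 0 then +oo%E else (Num.max 0 (- ln (`|u| / 2)))%:E.

Lemma logk_ge0 u : (0 <= logk u)%E.
Proof. by rewrite /logk; case: ifP => // _; rewrite lee_fin le_max lexx. Qed.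

Lemma logkN u : logk (- u) = logk u.
Proof. by rewrite /logk oppr_eq0 normrN. Qed.

Lemma logk_lt2 u : u != 0 -> `|u| <= 2 -> logk u = (- ln (`|u| / 2))%:E.
Proof.
move=> u0 u2; rewrite /logk (negPf u0); congr EFin; apply/max_idPr.
have un : 0 < `|u| by rewrite normr_gt0.
by rewrite oppr_ge0 ln_le0//; lra.
Qed.

Lemma measurable_logk : measurable_fun [set: R] logk.
Proof.
apply: measurable_fun_ifT => //.
- exact: measurable_fun_eqr.
- apply/measurable_EFinP; apply: measurable_maxr => //.
  apply: measurableT_comp => //; apply: measurableT_comp => //.
  apply: measurable_funM => //; exact: measurableT_comp.
Qed.

(** Both sides are logarithms of [(x - y) (x + y) = 2 g (quad g x - quad g
    y)]. *)
Lemma logk_quad (g x y : R) : 0 < g -> `|x| <= 1 -> `|y| <= 1 ->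
  `|quad g x| <= 1 -> `|quad g y| <= 1 ->
  (logk (x - y) + logk (x + y) =
   logk (quad g x - quad g y) + (- ln g)%:E)%E.
Proof.
move=> g0 hx hy hqx hqy.
have qE : quad g x - quad g y = (x - y) * (x + y) / (2 * g).
  by rewrite /quad; field; rewrite gt_eqF.
have le2 a b : `|a| <= 1 -> `|b| <= 1 -> `|a - b| <= 2 :> R.
  by move=> ha hb; rewrite (le_trans (ler_normB _ _))//; lra.
have [xy|xy] := eqVneq (x - y) 0.
  by rewrite qE xy !mul0r /logk !eqxx !addye// -ltNye// (lt_le_trans _ (logk_ge0 _)).
have [xy'|xy'] := eqVneq (x + y) 0.
  by rewrite qE xy' mulr0 !mul0r /logk !eqxx /= addye// addey// -ltNye// (lt_le_trans _ (logk_ge0 _)).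
have q0 : quad g x - quad g y != 0.
  by rewrite qE !mulf_neq0// invr_eq0 mulf_neq0 ?pnatr_eq0// gt_eqF.
rewrite (logk_lt2 xy) ?le2// (logk_lt2 q0) ?le2// (logk_lt2 xy'); last first.
  by rewrite -[y]opprK le2// normrN.
rewrite -!EFinD; congr EFin; rewrite -!opprD; congr (- _).
have n1 : 0 < `|x - y| by rewrite normr_gt0.
have n2 : 0 < `|x + y| by rewrite normr_gt0.
rewrite -!lnM ?posrE ?divr_gt0 ?normr_gt0//; congr ln.
rewrite qE !normrM normfV (@gtr0_norm _ (2 * g)) ?mulr_gt0//.
by field; rewrite gt_eqF.
Qed.

End LogarithmicKernel.

Section Mixture.
Context d (T : measurableType d) (R : realType) (P : probability T R).
Variables (a : T -> R) (ma : measurable_fun setT a).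

Let half : {nonneg R} := (2^-1)%:nng.
Let mNa : measurable_fun setT (fun x => - a x).
Proof. exact: measurableT_comp. Qed.

Let fa : {mfun T >-> measurableTypeR R} :=
  HB.pack_for {mfun T >-> measurableTypeR R} a (isMeasurableFun.Build _ _ T (measurableTypeR R) a ma).
Let fNa : {mfun T >-> measurableTypeR R} :=
  HB.pack_for {mfun T >-> measurableTypeR R} (fun x => - a x) (isMeasurableFun.Build _ _ T (measurableTypeR R) _ mNa).

(** The law of [a] with an independent random sign. *)
Definition symmetrized : set (measurableTypeR R) -> \bar R :=
  measure_add (mscale half (distribution P fa)) (mscale half (distribution P fNa)).

HB.instance Definition _ := Measure.on symmetrized.

Let symmetrizedT : symmetrized setT = 1%E.
Proof.
rewrite /symmetrized measure_addE /mscale.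
have p1 : distribution P fa setT = 1%E by exact: probability_setT.
have p2 : distribution P fNa setT = 1%E by exact: probability_setT.
transitivity (half%:num%:E * distribution P fa setT +
  half%:num%:E * distribution P fNa setT)%E; first by [].
by rewrite p1 p2 !mule1 -EFinD /half /=; congr EFin; field.
Qed.

HB.instance Definition _ := Measure_isProbability.Build _ _ _ symmetrized symmetrizedT.

Lemma symmetrizedE (A : set R) : measurable A ->
  symmetrized A = ((2^-1)%:E * P (a @^-1` A) + (2^-1)%:E * P ((fun x => - a x)%R @^-1` A))%E.
Proof. by move=> mA; rewrite /symmetrized measure_addE. Qed.

Lemma ge0_integral_symmetrized (f : R -> \bar R) :
  measurable_fun setT f -> (forall x, 0 <= f x)%E ->
  (\int[symmetrized]_x f x =
   (2^-1)%:E * \int[P]_x f (a x) + (2^-1)%:E * \int[P]_x f (- a x)%R)%E.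
Proof.
move=> mf f0; rewrite /symmetrized ge0_integral_measure_add//.
by rewrite !ge0_integral_mscale// !ge0_integral_distribution.
Qed.

End Mixture.

Section ProductIntegral.
Local Open Scope ereal_scope.
Context d (T : measurableType d) (R : realType) (P : probability T R).

Lemma product_full (A : set T) : measurable A -> P A = 1 ->
  (P \x P) (~` (A `*` A)) = 0.
Proof.
move=> mA PA; rewrite probability_setC; last exact: measurableX.
have PAA : (P \x P) (A `*` A) = P A * P A by exact: product_measure1E.
by rewrite [X in _ - X]PAA PA mule1 subee.
Qed.

Lemma eq_integral_product (A : set T) (f g : T * T -> \bar R) :
  measurable A -> P A = 1 ->
  measurable_fun setT f -> measurable_fun setT g ->
  (forall z, 0 <= f z) -> (forall z, 0 <= g z) ->
  (forall x y, A x -> A y -> f (x, y) = g (x, y)) ->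
  \int[P \x P]_z f z = \int[P \x P]_z g z.
Proof.
move=> mA PA mf mg f0 g0 fg; have N0 := product_full mA PA.
have mN : measurable (~` (A `*` A)) by apply: measurableC; exact: measurableX.
rewrite (ge0_negligible_integral mN)// [RHS](ge0_negligible_integral mN)//.
rewrite setTD setCK; apply: eq_integral => -[x y]; rewrite inE => -[/= Ax Ay].
exact: fg.
Qed.

Lemma le_integral_product (A : set T) (f g : T * T -> \bar R) :
  measurable A -> P A = 1 ->
  measurable_fun setT f -> measurable_fun setT g ->
  (forall z, 0 <= f z) -> (forall z, 0 <= g z) ->
  (forall x y, A x -> A y -> f (x, y) <= g (x, y)) ->
  \int[P \x P]_z f z <= \int[P \x P]_z g z.
Proof.
move=> mA PA mf mg f0 g0 fg; have N0 := product_full mA PA.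
have mN : measurable (~` (A `*` A)) by apply: measurableC; exact: measurableX.
rewrite (ge0_negligible_integral mN)// [leRHS](ge0_negligible_integral mN)//.
rewrite setTD setCK; apply: ge0_le_integral => //.
- exact: measurableX.
- exact: measurable_funTS.
- exact: measurable_funTS.
- by move=> [x y] [/= Ax Ay]; exact: fg.
Qed.

End ProductIntegral.

Section Energy.
Local Open Scope ereal_scope.
Context d (T : measurableType d) (R : realType) (P : probability T R).

Definition energy (X : T -> R) : \bar R :=
  \int[P \x P]_z logk (X z.1 - X z.2).

(** The mutual energy of the law of [X] and its image under [x -> - x]. *)
Definition reflected_energy (X : T -> R) : \bar R :=
  \int[P \x P]_z logk (X z.1 + X z.2).

Variables (X : T -> R) (mX : measurable_fun setT X).

Lemma measurable_logk_sub :
  measurable_fun setT (fun z : T * T => logk (X z.1 - X z.2)).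
Proof.
apply: (measurableT_comp (@measurable_logk R)); apply: measurable_funB.
  exact: (measurableT_comp mX).
exact: (measurableT_comp mX).
Qed.

Lemma measurable_logk_add :
  measurable_fun setT (fun z : T * T => logk (X z.1 + X z.2)).
Proof.
apply: (measurableT_comp (@measurable_logk R)); apply: measurable_funD.
  exact: (measurableT_comp mX).
exact: (measurableT_comp mX).
Qed.

Lemma energy_ge0 : 0 <= energy X.
Proof. by apply: integral_ge0 => z _; exact: logk_ge0. Qed.

Lemma reflected_energy_ge0 : 0 <= reflected_energy X.
Proof. by apply: integral_ge0 => z _; exact: logk_ge0. Qed.

Lemma energyE : energy X = \int[P]_x \int[P]_y logk (X x - X y).
Proof.
rewrite /energy fubini_tonelli1//; first exact: measurable_logk_sub.
by move=> z; exact: logk_ge0.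
Qed.

Lemma reflected_energyE :
  reflected_energy X = \int[P]_x \int[P]_y logk (X x + X y).
Proof.
rewrite /reflected_energy fubini_tonelli1//; first exact: measurable_logk_add.
by move=> z; exact: logk_ge0.
Qed.

Lemma ge0_half_add_half (x : \bar R) : 0 <= x -> (2^-1)%:E * x + (2^-1)%:E * x = x.
Proof.
move=> x0; rewrite -ge0_muleDl ?lee_fin ?invr_ge0// -EFinD.
have -> : (2^-1 + 2^-1 = 1 :> R)%R by field.
by rewrite mul1e.
Qed.

(** Of the four pairs of signs, two give the energy and two the mutual energy
    with the reflection. *)
Lemma energy_symmetrized :
  \int[symmetrized P mX \x symmetrized P mX]_z logk (z.1 - z.2) =
  (2^-1)%:E * energy X + (2^-1)%:E * reflected_energy X.
Proof.
have ml : measurable_fun setT (fun z : measurableTypeR R * measurableTypeR R =>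
    logk (z.1 - z.2)).
  by apply: (measurableT_comp (@measurable_logk R)); exact: measurable_funB.
rewrite fubini_tonelli1//; last by move=> z; exact: logk_ge0.
pose F (x : R) := (2^-1)%:E * \int[P]_y logk (x - X y)
  + (2^-1)%:E * \int[P]_y logk (x + X y).
have FE x : \int[symmetrized P mX]_y logk (x - y) = F x.
  rewrite ge0_integral_symmetrized; last 2 first.
  - apply: (measurableT_comp (@measurable_logk R)); exact: measurable_funB.
  - by move=> y; exact: logk_ge0.
  by congr (_ + _ * _); apply: eq_integral => y _; rewrite opprK.
have FN x : F (- x)%R = F x.
  rewrite /F addeC; congr (_ * _ + _ * _); apply: eq_integral => y _.
    by rewrite -logkN opprD opprK.
  by rewrite -logkN opprB opprK addrC.
have mF : measurable_fun setT F.
  rewrite (_ : F = fun x => \int[symmetrized P mX]_y logk (x - y)); last first.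
    by apply/funext => x; rewrite FE.
  have H := @measurable_fun_fubini_tonelli_F _ _ _ (measurableTypeR R) R (symmetrized P mX) _ ml.
  by apply: H => z; exact: logk_ge0.
have F0 x : 0 <= F x.
  by rewrite /F adde_ge0// mule_ge0 ?lee_fin ?invr_ge0//;
     apply: integral_ge0 => y _; exact: logk_ge0.
transitivity (\int[symmetrized P mX]_x F x).
  by apply: eq_integral => x _; rewrite -FE.
rewrite ge0_integral_symmetrized//.
under [X in _ + _ * X]eq_integral do rewrite FN.
rewrite ge0_half_add_half; last by apply: integral_ge0 => x _; exact: F0.
have m1 : measurable_fun setT (fun x => \int[P]_y logk (X x - X y)).
  apply: (@measurable_fun_fubini_tonelli_F _ _ _ _ _ P (fun z => logk (X z.1 - X z.2))).
    exact: measurable_logk_sub.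
  by move=> z; exact: logk_ge0.
have m2 : measurable_fun setT (fun x => \int[P]_y logk (X x + X y)).
  apply: (@measurable_fun_fubini_tonelli_F _ _ _ _ _ P (fun z => logk (X z.1 + X z.2))).
    exact: measurable_logk_add.
  by move=> z; exact: logk_ge0.
have p1 x : 0 <= \int[P]_y logk (X x - X y).
  by apply: integral_ge0 => y _; exact: logk_ge0.
have p2 x : 0 <= \int[P]_y logk (X x + X y).
  by apply: integral_ge0 => y _; exact: logk_ge0.
rewrite energyE reflected_energyE /F.
by rewrite ge0_integralD//; [rewrite !ge0_integralZl//|
  move=> x _; rewrite mule_ge0|exact: measurable_funeM|
  move=> x _; rewrite mule_ge0|exact: measurable_funeM].
Qed.

Lemma energy_add_reflected (Y : T -> R) (g : R) (A : set T) :
  measurable_fun setT Y -> (0 < g <= 1)%R -> measurable A -> P A = 1 ->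
  (forall x, A x -> [/\ (`|X x| <= 1)%R, (`|Y x| <= 1)%R & Y x = quad g (X x)]) ->
  energy X + reflected_energy X =
  \int[P \x P]_z logk (Y z.1 - Y z.2) + (- ln g)%:E.
Proof.
move=> mY /andP[g0 g1] mA PA H.
have mY' : measurable_fun setT (fun z : T * T => logk (Y z.1 - Y z.2)).
  apply: (measurableT_comp (@measurable_logk R)); apply: measurable_funB.
    exact: (measurableT_comp mY).
  exact: (measurableT_comp mY).
have lg : (0 <= - ln g)%R by rewrite oppr_ge0 ln_le0.
rewrite /energy /reflected_energy -ge0_integralD//; first last.
- exact: measurable_logk_add.
- by move=> z _; exact: logk_ge0.
- exact: measurable_logk_sub.
- by move=> z _; exact: logk_ge0.
have -> : (- ln g)%:E = \int[P \x P]_z (- ln g)%:E.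
  have PT : (P \x P) setT = 1 by exact: probability_setT.
  by rewrite integral_cst// [X in _ * X]PT mule1.
rewrite -ge0_integralD//; last by move=> z _; exact: logk_ge0.
apply: (eq_integral_product mA PA).
- by apply: emeasurable_funD; [exact: measurable_logk_sub|exact: measurable_logk_add].
- by apply: emeasurable_funD.
- by move=> z; rewrite adde_ge0// logk_ge0.
- by move=> z; rewrite adde_ge0// ?logk_ge0// lee_fin.
move=> x y Ax Ay /=.
have [hx hx' qx] := H x Ax; have [hy hy' qy] := H y Ay.
by rewrite qx qy (logk_quad g0)// -?qx -?qy.
Qed.

End Energy.

(** * Partial sums of the series of atanh *)

Section AtanhSeries.
Variable R : realType.
Implicit Types x q K : R.

Definition atanh_sum (n : nat) (q : R) : R :=
  \sum_(i < n) q ^+ (i.*2.+1) / (i.*2.+1)%:R.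

Definition atanh (q : R) : R := (ln (1 + q) - ln (1 - q)) / 2.

Lemma atanh_sumS n q :
  atanh_sum n.+1 q = atanh_sum n q + q ^+ (n.*2.+1) / (n.*2.+1)%:R.
Proof. by rewrite /atanh_sum big_ord_recr. Qed.

(** Differentiating removes the first [n] terms of the geometric series of [1
    / (1 - x ^+ 2)]. *)
Lemma is_derive_atanh_remainder n x : -1 < x < 1 ->
  is_derive x 1 (fun y => atanh y - atanh_sum n y) (x ^+ n.*2 / (1 - x ^+ 2)).
Proof.
move=> /andP[x1 x2]; elim: n => [|n IH].
  have d1 : is_derive x 1 (fun y => ln (1 + y)) (1 + x)^-1.
    have h : is_derive (1 + x) 1 (@ln R) (1 + x)^-1 by apply: is_derive1_ln; lra.
    have h' : is_derive x 1 (cst (1 : R) + id) 1.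
      by apply: is_derive_eq; rewrite add0r.
    have := is_derive1_comp h h'; rewrite mulr1; exact.
  have d2 : is_derive x 1 (fun y => ln (1 - y)) (- (1 - x)^-1).
    have h : is_derive (1 - x) 1 (@ln R) (1 - x)^-1 by apply: is_derive1_ln; lra.
    have h' : is_derive x 1 (cst (1 : R) - id) (-1).
      by apply: is_derive_eq; rewrite add0r.
    have := @is_derive1_comp R (@ln R) (cst (1 : R) - id) x _ _ h h'; rewrite mulrN1; exact.
  have d3 : is_derive x 1 (2^-1 \*: ((fun y => ln (1 + y)) - (fun y => ln (1 - y)))) (1 / (1 - x ^+ 2)).
    apply: is_derive_eq; rewrite /GRing.scale /=; field.
    by do ?[apply/andP; split]; rewrite ?gt_eqF//; nra.
  rewrite (_ : (fun y => _) = (fun y => 2^-1 *: (ln (1 + y) - ln (1 - y)))).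
    by rewrite double0 expr0.
  by apply/funext => y; rewrite /atanh_sum big_ord0 subr0 /atanh mulrC.
have d : is_derive x 1 (fun y : R => y ^+ n.*2.+1 / n.*2.+1%:R) (x ^+ n.*2).
  rewrite (_ : (fun y : R => _) = (n.*2.+1%:R^-1 \*: (id ^+ n.*2.+1))); last first.
    by apply/funext => y; rewrite /= fctE mulrC.
  apply: is_derive_eq; rewrite /GRing.scale /= mulr1 -mulr_natl mulrA mulVf ?mul1r//.
rewrite (_ : (fun y => _) = (fun y => atanh y - atanh_sum n y) - (fun y => y ^+ n.*2.+1 / n.*2.+1%:R)).
  apply: is_derive_eq; rewrite doubleS !exprS; field.
  by rewrite gt_eqF//; nra.
by apply/funext => y; rewrite atanh_sumS opprD addrA.
Qed.

Lemma atanh_remainder n q : 0 <= q < 1 ->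
  0 <= atanh q - atanh_sum n q <= q ^+ n.*2 / (1 - q ^+ 2).
Proof.
move=> /andP[q0 q1].
have [y||c cq] := @MVT_segment R (fun y => atanh y - atanh_sum n y)
  (fun x => x ^+ n.*2 / (1 - x ^+ 2)) 0 q q0.
- by rewrite in_itv /= => /andP[y0 yq]; apply: is_derive_atanh_remainder; apply/andP; split; lra.
- apply: derivable_within_continuous => y; rewrite in_itv /= => /andP[y0 yq].
  have [|] := @is_derive_atanh_remainder n y; last by [].
  by lra.
move: cq; rewrite in_itv /= => /andP[c0 cq].
have -> : atanh 0 - atanh_sum n 0 = 0.
  rewrite /atanh addr0 subr0 subrr mul0r sub0r /atanh_sum big1 ?oppr0// => i _.
  by rewrite exprS !mul0r.
rewrite !subr0 => ->.
have c2 : 0 < 1 - c ^+ 2 by nra.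
have q2 : 0 < 1 - q ^+ 2 by nra.
have e0 : 0 <= c ^+ n.*2 / (1 - c ^+ 2) by rewrite divr_ge0 ?exprn_ge0// ltW.
rewrite mulr_ge0//=.
have cqn : c ^+ n.*2 <= q ^+ n.*2 by rewrite lerXn2r ?nnegrE.
have : c ^+ n.*2 / (1 - c ^+ 2) <= q ^+ n.*2 / (1 - q ^+ 2).
  rewrite ler_pM ?exprn_ge0 ?invr_ge0 ?(ltW c2)// lef_pV2 ?posrE//; nra.
by apply: le_trans; rewrite ler_piMr// ltW.
Qed.

Lemma atanh_sum_le n q : 0 <= q < 1 -> atanh_sum n q <= atanh q.
Proof. by move=> /(atanh_remainder n)/andP[+ _]; rewrite subr_ge0. Qed.

Lemma atanh_sum_near q K : 0 <= q < 1 -> K < atanh q ->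
  \forall n \near \oo, K <= atanh_sum n q.
Proof.
move=> q01 Kq.
have q2 : 0 < 1 - q ^+ 2 by case/andP: (q01) => ? ?; nra.
have qq : `|q ^+ 2| < 1 by rewrite ger0_norm ?sqr_ge0//; lra.
have e0 : 0 < (atanh q - K) * (1 - q ^+ 2) by rewrite mulr_gt0// subr_gt0.
have /cvgrPdist_lt/(_ _ e0) := cvg_expr qq.
apply: filterS => n; rewrite sub0r normrN (ger0_norm (exprn_ge0 n (sqr_ge0 q))) => h.
have /andP[_ r] := atanh_remainder n q01.
have : q ^+ n.*2 / (1 - q ^+ 2) <= atanh q - K.
  by rewrite ler_pdivrMr// -muln2 mulnC exprM ltW.
by move=> /(le_trans r); lra.
Qed.

Lemma atanh_sum_homo n q q' : 0 <= q -> q <= q' -> atanh_sum n q <= atanh_sum n q'.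
Proof.
move=> q0 qq; apply: ler_sum => i _; rewrite ler_pM2r ?invr_gt0//.
by rewrite lerXn2r// nnegrE// (le_trans q0).
Qed.

Lemma atanh_surj K : 0 < K -> exists2 q, 0 < q < 1 & atanh q = K.
Proof.
move=> K0; pose e := expR (2 * K).
have e1 : 1 < e by rewrite expR_gt1 mulr_gt0.
exists ((e - 1) / (e + 1)).
  by rewrite divr_gt0 ?ltr_pdivrMr; lra.
have e2 : e + 1 != 0 by rewrite gt_eqF//; lra.
rewrite /atanh.
have -> : 1 + (e - 1) / (e + 1) = e * (2 / (e + 1)) by field.
have -> : 1 - (e - 1) / (e + 1) = 2 / (e + 1) by field.
have p : 0 < 2 / (e + 1) by rewrite divr_gt0//; lra.
rewrite lnM ?posrE//; last lra.
by rewrite addrK /e expRK mulrC mulKf.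
Qed.

Lemma atanh_le q q' : 0 <= q -> q <= q' -> q' < 1 -> atanh q <= atanh q'.
Proof.
move=> q0 qq q1; rewrite /atanh ler_pM2r ?invr_gt0//.
by apply: lerB; rewrite ler_ln ?posrE//; lra.
Qed.

End AtanhSeries.

(** * Finite-rank approximation of the odd part of the kernel *)

Section ApproximateKernel.
Variable R : realType.
Implicit Types x y q K : R.

(** For [x] the tangent of half an angle, [wfun] and [ufun] are the sine and
    the cosine of the angle. They separate the variables: [2xy / (x^2 + y^2) =
    w(x) w(y) / (1 - u(x) u(y))]. *)
Definition wfun x : R := 2 * x / (1 + x ^+ 2).
Definition ufun x : R := (1 - x ^+ 2) / (1 + x ^+ 2).
Definition geom (n : nat) q : R := \sum_(j < n) q ^+ j.
(** The function [atanh (2xy / (x^2 + y^2))] with its own series and the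
    geometric series of [1 / (1 - u(x) u(y))] both cut off after [n] terms;
    this is a polynomial in products [h x * h y]. *)
Definition approxk (n : nat) x y : R :=
  atanh_sum n (wfun x * wfun y * geom n (ufun x * ufun y)).

Lemma geomE n q : (1 - q) * geom n q = 1 - q ^+ n.
Proof.
elim: n => [|n IH]; first by rewrite /geom big_ord0 mulr0 expr0 subrr.
by rewrite /geom big_ord_recr /= mulrDr -/(geom n q) IH exprS; ring.
Qed.

Lemma wfunN x : wfun (- x) = - wfun x.
Proof. by rewrite /wfun sqrrN mulrN mulNr. Qed.

Lemma ufunN x : ufun (- x) = ufun x.
Proof. by rewrite /ufun sqrrN. Qed.

Lemma approxkN n x y : approxk n x (- y) = - approxk n x y.
Proof.
rewrite /approxk wfunN ufunN mulrN mulNr /atanh_sum -sumrN.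
by apply: eq_bigr => i _; rewrite exprNn -signr_odd /= odd_double expr1 mulN1r mulNr.
Qed.

Lemma ratio_wu x y : x * y != 0 ->
  wfun x * wfun y = 2 * x * y / (x ^+ 2 + y ^+ 2) * (1 - ufun x * ufun y).
Proof.
rewrite mulf_eq0 negb_or => /andP[x0 y0].
have hx : 0 < x ^+ 2 by rewrite exprn_even_gt0.
have hy : 0 < y ^+ 2 by rewrite exprn_even_gt0.
rewrite /wfun /ufun; field.
by do ?[apply/andP; split]; rewrite gt_eqF//; nra.
Qed.

Lemma ufun_bounds x : `|x| <= 1 -> x != 0 -> 0 <= ufun x < 1.
Proof.
move=> hx x0; have x2 : 0 < x ^+ 2 by rewrite exprn_even_gt0.
have x1 : x ^+ 2 <= 1 by rewrite -real_normK ?num_real// expr_le1.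
by rewrite /ufun divr_ge0 ?ltr_pdivrMr; lra.
Qed.

Lemma ufun2_bounds x y : `|x| <= 1 -> `|y| <= 1 -> x * y != 0 ->
  0 <= ufun x * ufun y < 1.
Proof.
move=> hx hy; rewrite mulf_eq0 negb_or => /andP[x0 y0].
have /andP[a b] := ufun_bounds hx x0; have /andP[c e] := ufun_bounds hy y0.
rewrite mulr_ge0//=; nra.
Qed.

Lemma kernel_arg n x y : `|x| <= 1 -> `|y| <= 1 -> 0 < x * y ->
  wfun x * wfun y * geom n (ufun x * ufun y) =
  2 * x * y / (x ^+ 2 + y ^+ 2) * (1 - (ufun x * ufun y) ^+ n).
Proof. by move=> hx hy xy; rewrite ratio_wu ?gt_eqF// -mulrA geomE. Qed.

Lemma ratio_bounds x y : 0 < x * y -> 0 < 2 * x * y / (x ^+ 2 + y ^+ 2) <= 1.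
Proof.
move=> xy; have s : 0 < x ^+ 2 + y ^+ 2 by nra.
have sq := sqr_ge0 (x - y).
by apply/andP; split; [rewrite divr_gt0//; nra|rewrite ler_pdivrMr//; nra].
Qed.

Lemma ratio_lt1 x y : 0 < x * y -> x != y -> 2 * x * y / (x ^+ 2 + y ^+ 2) < 1.
Proof.
move=> xy ny; have s : 0 < x ^+ 2 + y ^+ 2 by nra.
have : 0 < (x - y) ^+ 2 by rewrite exprn_even_gt0//= subr_eq0.
by rewrite ltr_pdivrMr//; nra.
Qed.

Lemma kernel_arg_bounds n x y : `|x| <= 1 -> `|y| <= 1 -> 0 < x * y ->
  0 <= wfun x * wfun y * geom n (ufun x * ufun y) <= 2 * x * y / (x ^+ 2 + y ^+ 2).
Proof.
move=> hx hy xy; rewrite kernel_arg//.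
have /andP[r0 _] := ratio_bounds xy.
have /andP[u0 u1] := ufun2_bounds hx hy (lt0r_neq0 xy).
have h : 0 <= (ufun x * ufun y) ^+ n <= 1 by rewrite exprn_ge0// exprn_ile1// ltW.
by case/andP: h => h0 h1; apply/andP; split; nra.
Qed.

(** Indeed [(1 + r) / (1 - r)] is the square of [(x + y) / (x - y)] for [r =
    2xy / (x^2 + y^2)]. *)
Lemma atanh_ratio x y : `|x| <= 1 -> `|y| <= 1 -> 0 < x * y -> x != y ->
  (logk (x - y) = (atanh (2 * x * y / (x ^+ 2 + y ^+ 2)))%:E + logk (x + y))%E.
Proof.
move=> hx hy xy ny.
have s : 0 < x ^+ 2 + y ^+ 2 by nra.
have d0 : x - y != 0 by rewrite subr_eq0.
have a0 : x + y != 0 by apply/eqP => e; have : y = - x by [lra]; nra.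
rewrite (logk_lt2 d0); last by rewrite (le_trans (ler_normB _ _))//; lra.
rewrite (logk_lt2 a0); last by rewrite (le_trans (ler_normD _ _))//; lra.
rewrite -EFinD; congr EFin; rewrite /atanh.
have -> : 1 + 2 * x * y / (x ^+ 2 + y ^+ 2) = `|x + y| ^+ 2 / (x ^+ 2 + y ^+ 2).
  by rewrite real_normK ?num_real//; field; rewrite gt_eqF.
have -> : 1 - 2 * x * y / (x ^+ 2 + y ^+ 2) = `|x - y| ^+ 2 / (x ^+ 2 + y ^+ 2).
  by rewrite real_normK ?num_real//; field; rewrite gt_eqF.
have n1 : 0 < `|x - y| by rewrite normr_gt0.
have n2 : 0 < `|x + y| by rewrite normr_gt0.
rewrite !ln_div ?posrE ?exprn_gt0// !lnXn//; first by field.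
Qed.

(** For [x y > 0] all terms of both series are positive, so the cut-offs stay
    below their sum. *)
Lemma approxk_le n x y : `|x| <= 1 -> `|y| <= 1 -> 0 <= x * y ->
  ((approxk n x y)%:E + logk (x + y) <= logk (x - y))%E.
Proof.
move=> hx hy; rewrite le_eqVlt => /orP[|xy].
  rewrite eq_sym => xy0.
  have -> : approxk n x y = 0.
    rewrite /approxk /wfun.
    have -> : 2 * x / (1 + x ^+ 2) * (2 * y / (1 + y ^+ 2)) = 0.
      by rewrite mulrACA [2 * x * _]mulrACA (eqP xy0) mulr0 mul0r.
    rewrite mul0r /atanh_sum big1// => i _; by rewrite exprS !mul0r.
  rewrite add0e; move: xy0; rewrite mulf_eq0 => /orP[] /eqP ->.
    by rewrite add0r sub0r logkN.
  by rewrite addr0 subr0.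
have [->|ny] := eqVneq x y.
  by rewrite subrr [X in (_ <= X)%E]/logk eqxx leey.
rewrite atanh_ratio// leeD2r// lee_fin.
have /andP[a0 a1] := kernel_arg_bounds n hx hy xy.
have r1 := ratio_lt1 xy ny.
apply: (le_trans (atanh_sum_homo _ a0 a1)); apply: atanh_sum_le.
by rewrite r1 (le_trans a0).
Qed.

(** On the diagonal the limit is infinite, so it is approached through a
    number [q] below the ratio for which [atanh q] already exceeds the
    required value. *)
Lemma approxk_near x y K : `|x| <= 1 -> `|y| <= 1 -> 0 < x * y ->
  (K%:E < logk (x - y))%E ->
  \forall n \near \oo, (K%:E <= (approxk n x y)%:E + logk (x + y))%E.
Proof.
move=> hx hy xy hK.
have a0 : x + y != 0 by apply/eqP => e; have : y = - x by [lra]; nra.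
have a2 : `|x + y| <= 2 by rewrite (le_trans (ler_normD _ _))//; lra.
rewrite (logk_lt2 a0 a2); set c := - ln _.
suff H : \forall n \near \oo, K - c <= approxk n x y.
  by apply: filterS H => n h; rewrite -EFinD lee_fin; lra.
have a_ge0 n : 0 <= approxk n x y.
  have /andP[e0 e1] := kernel_arg_bounds n hx hy xy.
  by apply: sumr_ge0 => i _; rewrite divr_ge0// exprn_ge0.
have [K0|K0] := leP (K - c) 0; first by apply: nearW => n; rewrite (le_trans K0).
have [q [q01 Kq qR]] : exists q, [/\ 0 < q < 1, K - c < atanh q &
    q < 2 * x * y / (x ^+ 2 + y ^+ 2)].
  have [xyE|ny] := eqVneq x y.
    have [q q01 qE] := @atanh_surj R (K - c + 1) ltac:(lra).
    exists q; split=> //; first by rewrite qE; lra.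
    have y2 : 0 < y * y by rewrite -[X in X * _]xyE.
    have -> : 2 * x * y / (x ^+ 2 + y ^+ 2) = 1.
      have -> : 2 * x * y = 2 * (y * y) by rewrite xyE; ring.
      have -> : x ^+ 2 + y ^+ 2 = 2 * (y * y) by rewrite xyE; ring.
      by rewrite divff// gt_eqF// mulr_gt0.
    by case/andP: q01.
  move: hK; rewrite atanh_ratio// (logk_lt2 a0 a2) -/c -EFinD lte_fin => hK.
  set r := 2 * x * y / _ in hK *.
  have [q q01 qE] := @atanh_surj R ((K - c + atanh r) / 2) ltac:(lra).
  exists q; split=> //; first by rewrite qE; lra.
  rewrite ltNge; apply/negP => rq.
  have /andP[r0 _] := ratio_bounds xy.
  have := @atanh_le R r q (ltW r0) rq; rewrite qE.
  by case/andP: q01 => _ q1 => /(_ q1); lra.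
have /andP[q0 q1] := q01.
set r := 2 * x * y / _ in qR.
have r0 : 0 < r by rewrite (lt_trans q0).
have /andP[u0 u1] := ufun2_bounds hx hy (lt0r_neq0 xy).
have un : `|ufun x * ufun y| < 1 by rewrite ger0_norm.
have d0 : 0 < 1 - q / r by rewrite subr_gt0 ltr_pdivrMr// mul1r.
have N1 := @atanh_sum_near R q _ ltac:(lra) Kq.
have /cvgrPdist_lt/(_ _ d0) N2 := cvg_expr un.
near=> n.
have h1 : K - c <= atanh_sum n q by near: n.
have : `|0 - (ufun x * ufun y) ^+ n| < 1 - q / r by near: n.
rewrite sub0r normrN ger0_norm ?exprn_ge0// => h2.
apply: (le_trans h1); apply: atanh_sum_homo; first exact: ltW.
rewrite kernel_arg// -/r.
have -> : q = r * (q / r) by rewrite mulrC divfK// gt_eqF.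
rewrite ler_pM2l//; lra.
Unshelve. all: by end_near. Qed.

End ApproximateKernel.

(** * Means and positive kernels of finite rank *)

Section LimInf.
Local Open Scope ereal_scope.
Variable R : realType.
Implicit Types (u : (\bar R)^nat) (c l : \bar R).

Lemma limn_einf_le_bound u c : (forall n, u n <= c) -> limn_einf u <= c.
Proof.
move=> uc; rewrite limn_einf_lim; apply: lime_le; first exact: is_cvg_einfs.
apply: nearW => n; apply: le_trans (uc n).
by apply: ereal_inf_lbound; exists n => //=.
Qed.

Lemma le_limn_einf u l :
  (forall K : R, K%:E < l -> \forall n \near \oo, K%:E <= u n) ->
  l <= limn_einf u.
Proof.
move=> H; rewrite leNgt; apply/negP => ul.
have [K uK Kl] : exists2 K : R, limn_einf u < K%:E & K%:E < l.
  case: (limn_einf u) l ul {H} => [a| |] [b| |] //=.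
  - rewrite lte_fin => ab; exists ((a + b) / 2)%R; rewrite lte_fin; lra.
  - by move=> _; exists (a + 1)%R; rewrite ?ltry// lte_fin; lra.
  - by move=> _; exists (b - 1)%R; rewrite ?ltNyr// lte_fin; lra.
  - by move=> _; exists 0%R; rewrite ?ltNyr ?ltry.
move: uK; apply/negP; rewrite -leNgt limn_einf_lim.
apply: lime_ge; first exact: is_cvg_einfs.
have [N _ HN] := H K Kl.
exists N => // n /= Nn; apply: le_ereal_inf_tmp => _ [k /= nk <-].
by apply: HN; rewrite /= (leq_trans Nn).
Qed.

End LimInf.

Section Mean.
Local Open Scope ereal_scope.
Context d (T : measurableType d) (R : realType) (P : probability T R).

Definition mean (f : T -> R) : R := fine (\int[P]_x (f x)%:E).

Definition bounded_measurable (f : T -> R) : Prop :=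
  measurable_fun setT f /\ exists M : R, forall x, (`|f x| <= M)%R.

Lemma bounded_measurable_integrable f :
  bounded_measurable f -> P.-integrable setT (EFin \o f).
Proof.
move=> [mf [M fM]]; apply: measurable_bounded_integrable => //.
  apply: (@le_lt_trans _ _ 1); last exact: ltry.
  by apply: probability_le1.
exists M; split; first exact: num_real.
by move=> x Mx y _; exact: le_trans (fM y) (ltW Mx).
Qed.

Lemma meanE f : P.-integrable setT (EFin \o f) -> \int[P]_x (f x)%:E = (mean f)%:E.
Proof. by move=> If; rewrite fineK// integrable_fin_num. Qed.

Lemma meanD f g : P.-integrable setT (EFin \o f) -> P.-integrable setT (EFin \o g) ->
  mean (fun x => f x + g x)%R = (mean f + mean g)%R.
Proof.
move=> If Ig; apply: EFin_inj; rewrite EFinD -!meanE//; last first.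
  by apply: (eq_integrable _ ((EFin \o f) \+ (EFin \o g))) => //; exact: integrableD.
by rewrite -integralD_EFin//; apply: eq_integral => x _.
Qed.

Lemma meanZ f a : P.-integrable setT (EFin \o f) ->
  mean (fun x => a * f x)%R = (a * mean f)%R.
Proof.
move=> If; apply: EFin_inj; rewrite EFinM -!meanE//; last first.
  by apply: (eq_integrable _ (fun x => a%:E * (EFin \o f) x)) => //; exact: integrableZl.
by rewrite -integralZl//; apply: eq_integral => x _.
Qed.

Lemma bounded_measurableM f g : bounded_measurable f -> bounded_measurable g ->
  bounded_measurable (fun x => f x * g x)%R.
Proof.
move=> [mf [M fM]] [mg [N gN]]; split; first exact: measurable_funM.
by exists (M * N)%R => x; rewrite normrM ler_pM.
Qed.

Lemma bounded_measurableZ f a : bounded_measurable f ->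
  bounded_measurable (fun x => a * f x)%R.
Proof.
move=> [mf [M fM]]; split; first exact: measurable_funM.
by exists (`|a| * M)%R => x; rewrite normrM ler_wpM2l.
Qed.

(** Sums of products [f x * f y]. This syntactic form of positivity is visibly
    stable under products, which the expansion of the kernel needs. *)
Inductive finite_rank_psd : (T -> T -> R) -> Prop :=
| psd_rank1 f : bounded_measurable f -> finite_rank_psd (fun x y => f x * f y)%R
| psd_add k l : finite_rank_psd k -> finite_rank_psd l ->
    finite_rank_psd (fun x y => k x y + l x y)%R.

Lemma psd_ext k l : (forall x y, k x y = l x y) -> finite_rank_psd k -> finite_rank_psd l.
Proof. by move=> kl; have -> : k = l by apply/funext => x; apply/funext => y. Qed.

Lemma psd0 : finite_rank_psd (fun _ _ => 0%R).
Proof.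
apply: (psd_ext (k := fun _ _ => 0 * 0)%R) => [x y|]; first by rewrite mulr0.
by apply: (@psd_rank1 (fun=> 0%R)); split=> //; exists 0%R => x; rewrite normr0.
Qed.

Lemma psd_scale a k : (0 <= a)%R -> finite_rank_psd k ->
  finite_rank_psd (fun x y => a * k x y)%R.
Proof.
move=> a0; elim=> [f bf|k' l _ IHk _ IHl].
  apply: (psd_ext (k := fun x y => (Num.sqrt a * f x) * (Num.sqrt a * f y))%R).
    by move=> x y; rewrite mulrACA -expr2 sqr_sqrtr.
  by apply: (@psd_rank1 (fun x => Num.sqrt a * f x)%R); exact: bounded_measurableZ.
by apply: (psd_ext _ (psd_add IHk IHl)) => x y; rewrite mulrDr.
Qed.

Lemma psd_mul k l : finite_rank_psd k -> finite_rank_psd l ->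
  finite_rank_psd (fun x y => k x y * l x y)%R.
Proof.
move=> + psdl; elim=> [f bf|k1 k2 _ IH1 _ IH2]; last first.
  by apply: (psd_ext _ (psd_add IH1 IH2)) => x y; rewrite mulrDl.
elim: psdl => [g bg|l1 l2 _ IH1 _ IH2]; last first.
  by apply: (psd_ext _ (psd_add IH1 IH2)) => x y; rewrite mulrDr.
apply: (psd_ext (k := fun x y => (f x * g x) * (f y * g y))%R).
  by move=> x y; rewrite mulrACA.
by apply: (@psd_rank1 (fun x => f x * g x)%R); exact: bounded_measurableM.
Qed.

Lemma psd_sum (I : Type) (r : seq I) (Q : pred I) (k : I -> T -> T -> R) :
  (forall i, Q i -> finite_rank_psd (k i)) ->
  finite_rank_psd (fun x y => \sum_(i <- r | Q i) k i x y)%R.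
Proof.
move=> H; elim: r => [|i r IH].
  by apply: (psd_ext _ psd0) => x y; rewrite big_nil.
have [Qi|nQi] := boolP (Q i).
  by apply: (psd_ext _ (psd_add (H i Qi) IH)) => x y; rewrite big_cons Qi.
by apply: (psd_ext _ IH) => x y; rewrite big_cons (negPf nQi).
Qed.

Lemma integral_rank1 f : bounded_measurable f ->
  (P \x P).-integrable setT (fun z : T * T => (f z.1 * f z.2)%:E) /\
  \int[P \x P]_z (f z.1 * f z.2)%:E = (mean f ^+ 2)%:E.
Proof.
move=> bf; have [mf [M fM]] := bf.
have If := bounded_measurable_integrable bf.
have I2 : (P \x P).-integrable setT (EFin \o (fun z : T * T => f z.1 * f z.2)%R).
  apply: measurable_bounded_integrable => //.
  - apply: (@le_lt_trans _ _ 1); last exact: ltry.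
    by apply: probability_le1.
  - apply: measurable_funM; first exact: (measurableT_comp mf).
    exact: (measurableT_comp mf).
  exists (M * M)%R; split; first exact: num_real.
  move=> x Mx y _; apply: le_trans (ltW Mx); rewrite /= normrM.
  by apply: ler_pM.
split=> //; rewrite -integral12_prod_meas1//= /fubini_F.
transitivity (\int[P]_x ((mean f)%:E * (f x)%:E)).
  apply: eq_integral => x _ /=.
  transitivity (\int[P]_y ((f x)%:E * (f y)%:E)); first by apply: eq_integral.
  by rewrite integralZl// (meanE If) muleC.
by rewrite integralZl// (meanE If) expr2 EFinM.
Qed.

Lemma integral_psd k : finite_rank_psd k ->
  (P \x P).-integrable setT (fun z : T * T => (k z.1 z.2)%:E) /\
  0 <= \int[P \x P]_z (k z.1 z.2)%:E.
Proof.
elim=> [f bf|k1 k2 _ [I1 p1] _ [I2 p2]].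
  by have [I1 ->] := integral_rank1 bf; split=> //; rewrite lee_fin sqr_ge0.
have := integrableD measurableT I1 I2 => I3; split=> //.
rewrite (_ : \int[_]_z _ = \int[P \x P]_z ((k1 z.1 z.2)%:E + (k2 z.1 z.2)%:E)).
  by rewrite integralD// adde_ge0.
by apply: eq_integral.
Qed.

End Mean.

(** * Reflection positivity *)

Section ReflectionPositivity.
Context d (T : measurableType d) (R : realType) (P : probability T R).
Variables (X : T -> R) (mX : measurable_fun setT X).

Lemma measurable_wfun : measurable_fun [set: R] (@wfun R).
Proof.
apply: continuous_measurable_fun => x; apply: cvgM; first by apply: cvgM; [exact: cvg_cst|exact: cvg_id].
apply: cvgV; first by rewrite gt_eqF//; have := sqr_ge0 x; lra.
by apply: cvgD; [exact: cvg_cst|exact: exprn_continuous].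
Qed.

Lemma measurable_ufun : measurable_fun [set: R] (@ufun R).
Proof.
apply: continuous_measurable_fun => x; apply: cvgM.
  by apply: cvgB; [exact: cvg_cst|exact: exprn_continuous].
apply: cvgV; first by rewrite gt_eqF//; have := sqr_ge0 x; lra.
by apply: cvgD; [exact: cvg_cst|exact: exprn_continuous].
Qed.

Lemma bounded_measurable_wfun : bounded_measurable (fun t => wfun (X t)).
Proof.
split; first exact: (measurableT_comp measurable_wfun mX).
exists 1 => t; have := sqr_ge0 (X t); set x := X t => x2.
have p : 0 < 1 + x ^+ 2 by lra.
rewrite /wfun ler_norml; have := sqr_ge0 (1 - x); have := sqr_ge0 (1 + x) => h1 h2.
by rewrite ler_pdivrMr// ler_pdivlMr//; apply/andP; split; nra.
Qed.

Lemma bounded_measurable_ufun : bounded_measurable (fun t => ufun (X t)).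
Proof.
split; first exact: (measurableT_comp measurable_ufun mX).
exists 1 => t; have := sqr_ge0 (X t); set x := X t => x2.
have p : 0 < 1 + x ^+ 2 by lra.
rewrite /ufun ler_norml.
by rewrite ler_pdivrMr// ler_pdivlMr//; apply/andP; split; nra.
Qed.

Lemma bounded_measurableXn (f : T -> R) n : bounded_measurable f ->
  bounded_measurable (fun t => f t ^+ n).
Proof.
move=> bf; elim: n => [|n IH].
  split; first exact: measurable_cst.
  by exists 1 => t; rewrite expr0 normr1.
have := bounded_measurableM bf IH; congr bounded_measurable.
by apply/funext => t; rewrite exprS.
Qed.

Definition wu_moment (j : nat) (t : T) : R := wfun (X t) * ufun (X t) ^+ j.

Lemma bounded_measurable_wu j : bounded_measurable (wu_moment j).
Proof.
apply: bounded_measurableM; first exact: bounded_measurable_wfun.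
exact: bounded_measurableXn bounded_measurable_ufun.
Qed.

Lemma psdXn (k : T -> T -> R) n : finite_rank_psd k ->
  finite_rank_psd (fun x y => k x y ^+ n.+1).
Proof.
move=> hk; elim: n => [|n IH]; first by apply: (psd_ext _ hk) => x y; rewrite expr1.
by apply: (psd_ext _ (psd_mul hk IH)) => x y; rewrite [RHS]exprS.
Qed.

(** The removed product is the [j]-th term of the geometric series inside the
    first term of the series of [atanh]. *)
Lemma psd_approxk n j : (j < n)%N ->
  finite_rank_psd (fun x y => approxk n (X x) (X y) - wu_moment j x * wu_moment j y).
Proof.
case: n => // n jn.
pose a x y := wfun (X x) * wfun (X y) * geom n.+1 (ufun (X x) * ufun (X y)).
have aE x y : a x y = \sum_(i < n.+1) wu_moment i x * wu_moment i y.
  rewrite /a /geom mulr_sumr; apply: eq_bigr => i _.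
  by rewrite /wu_moment exprMn mulrACA.
have pa : finite_rank_psd a.
  apply: (psd_ext (k := fun x y => \sum_(i < n.+1) wu_moment i x * wu_moment i y)).
    by move=> x y; rewrite aE.
  by apply: psd_sum => i _; apply: psd_rank1; exact: bounded_measurable_wu.
have p1 : finite_rank_psd (fun x y => \sum_(i < n.+1 | i != Ordinal jn) wu_moment i x * wu_moment i y).
  by apply: psd_sum => i _; apply: psd_rank1; exact: bounded_measurable_wu.
have p2 : finite_rank_psd (fun x y => \sum_(i < n) (i.+1.*2.+1)%:R^-1 * a x y ^+ i.+1.*2.+1).
  by apply: psd_sum => i _; apply: psd_scale; [rewrite invr_ge0 ler0n|exact: (@psdXn _ _ pa)].
apply: (psd_ext _ (psd_add p1 p2)) => x y.
have E1 : approxk n.+1 (X x) (X y) = a x y +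
    \sum_(i < n) (i.+1.*2.+1)%:R^-1 * a x y ^+ i.+1.*2.+1.
  change (atanh_sum n.+1 (a x y) = a x y +
    \sum_(i < n) (i.+1.*2.+1)%:R^-1 * a x y ^+ i.+1.*2.+1).
  rewrite /atanh_sum big_ord_recl expr1 divr1; congr (_ + _).
  by apply: eq_bigr => i _; rewrite lift0 mulrC.
have E2 : a x y = wu_moment j x * wu_moment j y +
    \sum_(i < n.+1 | i != Ordinal jn) wu_moment i x * wu_moment i y.
  by rewrite aE (bigD1 (Ordinal jn)).
rewrite E1 [X in _ = X + _ - _]E2; ring.
Qed.

Local Open Scope ereal_scope.

Hypothesis X1 : forall t, (`|X t| <= 1)%R.
Hypothesis EX : energy P X < +oo.

(** For [x y >= 0] the cut-off series is below [k(x - y) - k(x + y)];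
    otherwise it is
    at most 0. *)
Lemma logk_sub_approxk_ge0 n x y :
  0 <= logk (X x - X y) - (approxk n (X x) (X y))%:E.
Proof.
rewrite sube_ge0//.
have [xy|xy] := leP 0%R (X x * X y)%R.
  apply: le_trans (approxk_le n (X1 x) (X1 y) xy).
  by rewrite leeDl// logk_ge0.
apply: le_trans (logk_ge0 _); rewrite lee_fin -oppr_ge0 -approxkN.
have X1N : (`|- X y| <= 1)%R by rewrite normrN.
have [| a0 _] := andP (kernel_arg_bounds n (X1 x) X1N _); first by rewrite mulrN oppr_gt0.
by apply: sumr_ge0 => i _; rewrite divr_ge0// exprn_ge0.
Qed.

Lemma integrable_logk_sub :
  (P \x P).-integrable setT (fun z : T * T => logk (X z.1 - X z.2)).
Proof.
apply/integrableP; split; first exact: measurable_logk_sub.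
rewrite (eq_integral (fun z => logk (X z.1 - X z.2))) => [//|z _].
by rewrite gee0_abs// logk_ge0.
Qed.

(** Integrate [k(x - y) - Phi_n(x, y)], where [Phi_n] is the cut-off kernel.
    It is nonnegative and its lower limit is at least [k(x + y)]; the integral
    of [Phi_n] is at least the square of the moment, by positivity. Fatou
    concludes without any integrability of [k(x + y)]. *)
Theorem reflected_energy_gap j :
  reflected_energy P X + (mean P (wu_moment j) ^+ 2)%:E <= energy P X.
Proof.
(* The shift by [j.+1] makes every cut-off contain the [j]-th moment. *)
pose Phi n (z : T * T) : R := approxk (n + j.+1) (X z.1) (X z.2).
pose B n (z : T * T) := logk (X z.1 - X z.2) - (Phi n z)%:E.
have IPhi n : (P \x P).-integrable setT (EFin \o Phi n) /\
    (mean P (wu_moment j) ^+ 2)%:E <= \int[P \x P]_z (Phi n z)%:E.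
  have [|I1 p1] := integral_psd P (@psd_approxk (n + j.+1) j _); first by rewrite addnS ltnS leq_addl.
  have [I2 p2] := integral_rank1 P (bounded_measurable_wu j).
  have E z : (Phi n z)%:E = (approxk (n + j.+1) (X z.1) (X z.2) - wu_moment j z.1 * wu_moment j z.2)%:E
      + (wu_moment j z.1 * wu_moment j z.2)%:E.
    by rewrite -EFinD subrK.
  split.
    have I3 := integrableD measurableT I1 I2.
    by move: I3; apply: eq_integrable => // z _; rewrite /= E.
  rewrite (eq_integral _ _ (fun z _ => E z)) integralD//.
  by rewrite [X in _ <= _ + X]p2 leeDr.
have IB n : \int[P \x P]_z B n z <= energy P X - (mean P (wu_moment j) ^+ 2)%:E.
  have [I1 p1] := IPhi n.
  rewrite /B integralB//; last exact: integrable_logk_sub.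
  by rewrite leeB.
rewrite -leeBrDr//.
have mB n : measurable_fun setT (B n).
  apply: emeasurable_funB; first exact: measurable_logk_sub.
  by have [/integrableP[]] := IPhi n.
have B0 n z : setT z -> 0 <= B n z by move=> _; exact: logk_sub_approxk_ge0.
apply: le_trans (limn_einf_le_bound IB).
apply: le_trans (fatou (P \x P) measurableT mB B0).
apply: ge0_le_integral => //.
- by move=> z _; exact: logk_ge0.
- exact: measurable_logk_add.
- apply: (emeasurable_fun_cvg (fun n z => einfs (B^~ z) n)) => [n|z _].
    exact: measurable_fun_einfs.
  by rewrite limn_einf_lim; exact: is_cvg_einfs.
move=> z _; apply: le_limn_einf => K hK.
have [xy|xy] := leP 0%R (X z.1 * X z.2)%R.
  apply: nearW => n; apply: (le_trans (ltW hK)).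
  rewrite /B leeBrDr// addeC; exact: approxk_le.
have X1N : (`|- X z.2| <= 1)%R by rewrite normrN.
have xyN : (0 < X z.1 * - X z.2)%R by rewrite mulrN oppr_gt0.
have hKN : K%:E < logk (X z.1 - - X z.2) by rewrite opprK.
have [N _ HN] := approxk_near (X1 z.1) X1N xyN hKN.
exists N => // n /= Nn.
have := HN (n + j.+1)%N; rewrite /= (leq_trans Nn) ?leq_addr// => /(_ isT).
by rewrite approxkN addeC.
Qed.

End ReflectionPositivity.

(** * Vanishing of the odd moments *)

Section OddMoments.
Context d (T : measurableType d) (R : realType) (P : probability T R).

Lemma bounded_measurable_cst (a : R) : bounded_measurable (fun _ : T => a).
Proof. by split; [exact: measurable_cst|exists `|a|]. Qed.

Lemma bounded_measurableD (f g : T -> R) : bounded_measurable f ->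
  bounded_measurable g -> bounded_measurable (fun t => f t + g t).
Proof.
move=> [mf [M fM]] [mg [N gN]]; split; first exact: measurable_funD.
by exists (M + N) => t; rewrite (le_trans (ler_normD _ _))// lerD.
Qed.

Lemma bounded_measurable_horner (g : T -> R) (p : {poly R}) :
  bounded_measurable g -> bounded_measurable (fun t => p.[g t]).
Proof.
move=> bg; elim/poly_ind: p => [|p c IH].
  have := bounded_measurable_cst 0; congr bounded_measurable.
  by apply/funext => t; rewrite horner0.
have := bounded_measurableD (bounded_measurableM IH bg) (bounded_measurable_cst c).
by congr bounded_measurable; apply/funext => t; rewrite !hornerE.
Qed.

Lemma mean_horner_eq0 (f g : T -> R) (p : {poly R}) :
  bounded_measurable f -> bounded_measurable g ->
  (forall j, mean P (fun t => f t * g t ^+ j) = 0) ->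
  mean P (fun t => f t * p.[g t]) = 0.
Proof.
move=> bf bg H.
suff S n : mean P (fun t => f t * \sum_(j < n) p`_j * g t ^+ j) = 0 /\
    bounded_measurable (fun t => f t * \sum_(j < n) p`_j * g t ^+ j).
  rewrite -[RHS](S (size p)).1; congr mean; apply/funext => t.
  by rewrite horner_coef.
elim: n => [|n [IH bI]].
  have E : (fun t : T => f t * \sum_(j < 0) p`_j * g t ^+ j) = fun t => 0 * f t.
    by apply/funext => t; rewrite big_ord0 mulr0 mul0r.
  rewrite E; split; last exact: bounded_measurableZ.
  by rewrite meanZ ?mul0r//; exact: bounded_measurable_integrable.
have bn : bounded_measurable (fun t => p`_n * (f t * g t ^+ n)).
  by apply: bounded_measurableZ; apply: bounded_measurableM => //; exact: bounded_measurableXn.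
have E : (fun t : T => f t * \sum_(j < n.+1) p`_j * g t ^+ j) =
    fun t => f t * (\sum_(j < n) p`_j * g t ^+ j) + p`_n * (f t * g t ^+ n).
  by apply/funext => t; rewrite big_ord_recr /=; ring.
rewrite E; split; last exact: bounded_measurableD.
rewrite meanD ?IH ?meanZ ?H ?mulr0 ?addr0//; try exact: bounded_measurable_integrable.
apply: bounded_measurable_integrable; apply: bounded_measurableM => //.
exact: bounded_measurableXn.
Qed.

Lemma mean_norm_le (f : T -> R) (M : R) : bounded_measurable f ->
  (forall t, `|f t| <= M) -> `|mean P f| <= M.
Proof.
move=> bf fM; have If := bounded_measurable_integrable P bf.
rewrite -lee_fin -abse_EFin -meanE//.
have [mf _] := bf.
apply: (@le_trans _ _ (\int[P]_x `|(f x)%:E|)%E).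
  by apply: le_abse_integral => //; exact/measurable_EFinP.
have -> : M%:E = (\int[P]_x M%:E)%E.
  have PT : P setT = 1%E by exact: probability_setT.
  by rewrite integral_cst// [X in (_ * X)%E]PT mule1.
apply: ge0_le_integral => //.
- by apply: measurableT_comp => //; exact/measurable_EFinP.
- by move=> x _; rewrite abse_EFin lee_fin.
Qed.

Variables (X : T -> R) (mX : measurable_fun setT X).
Hypothesis X1 : forall t, `|X t| <= 1.
Hypothesis H0 : forall j, mean P (wu_moment X j) = 0.

Let w t := wfun (X t).
Let u t := ufun (X t).
Let v t := 1 + X t ^+ 2.

Let bw : bounded_measurable w.
Proof. exact: bounded_measurable_wfun. Qed.

Let bu : bounded_measurable u.
Proof. exact: bounded_measurable_ufun. Qed.

Let bX : bounded_measurable X.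
Proof. by split=> //; exists 1. Qed.

Let bv : bounded_measurable v.
Proof.
by apply: bounded_measurableD; [exact: bounded_measurable_cst|exact: bounded_measurableXn].
Qed.

Let v_gt0 t : 0 < v t.
Proof. by rewrite /v; have := sqr_ge0 (X t); lra. Qed.

(** Here [1 / v = (1 + u) / 2]. Multiplying by [1 = (1 + u) / 2 + (1 - u) / 2]
    lowers the power of [v] in the first part, whose mean vanishes by
    induction; so the mean is unchanged when [p] is multiplied by [(1 - u) /
    2], which lies in [0, 1 / 2]; iterating makes it arbitrarily small. *)
Lemma mean_w_horner_v (p : {poly R}) b :
  mean P (fun t => w t * v t ^+ b * p.[u t]) = 0.
Proof.
elim: b p => [|b IH] p.
  rewrite -[RHS](@mean_horner_eq0 w u p bw bu H0); congr mean.
  by apply/funext => t; rewrite expr0 mulr1.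
pose q : {poly R} := 2^-1 *: (1 - 'X).
have qE t : q.[u t] = (1 - u t) / 2 by rewrite !hornerE mulrC.
have bh r : bounded_measurable (fun t => w t * v t ^+ b.+1 * r.[u t]).
  apply: bounded_measurableM; last exact: bounded_measurable_horner.
  by apply: bounded_measurableM => //; exact: bounded_measurableXn.
have bh' r : bounded_measurable (fun t => w t * v t ^+ b * r.[u t]).
  apply: bounded_measurableM; last exact: bounded_measurable_horner.
  by apply: bounded_measurableM => //; exact: bounded_measurableXn.
have step r : mean P (fun t => w t * v t ^+ b.+1 * r.[u t]) =
    mean P (fun t => w t * v t ^+ b.+1 * (r * q).[u t]).
  rewrite -[RHS]add0r -(IH r) -meanD; try exact: bounded_measurable_integrable.
  congr mean; apply/funext => t; rewrite hornerM qE.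
  have -> : u t = 2 / v t - 1 by rewrite /u /ufun /v; field; rewrite gt_eqF//; have := sqr_ge0 (X t); nra.
  by rewrite exprS; field; rewrite gt_eqF.
have iter i : mean P (fun t => w t * v t ^+ b.+1 * p.[u t]) =
    mean P (fun t => w t * v t ^+ b.+1 * (p * q ^+ i).[u t]).
  elim: i => [|i IHi]; first by rewrite expr0 mulr1.
  by rewrite IHi step -(mulrA p) -exprSr.
have [_ [M hM]] := bh p.
have M0 : 0 <= M by have := hM point; apply: le_trans.
have small i : `|mean P (fun t => w t * v t ^+ b.+1 * p.[u t])| <= M * (1 / 2) ^+ i.
  rewrite (iter i); apply: mean_norm_le => // t.
  rewrite hornerM mulrA normrM ler_pM// horner_exp normrX lerXn2r ?nnegrE//.
  have := sqr_ge0 (X t); have : X t ^+ 2 <= 1.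
    by rewrite -real_normK ?num_real// expr_le1.
  move=> x1 x0; rewrite qE.
  have -> : (1 - u t) / 2 = X t ^+ 2 / (1 + X t ^+ 2).
    by rewrite /u /ufun; field; rewrite gt_eqF//; lra.
  rewrite ger0_norm ?ler_pdivrMr ?divr_ge0//; lra.
apply/eqP; rewrite -normr_le0; apply/ler_addgt0Pr => e e0; rewrite add0r.
have h : `|(1 / 2 : R)| < 1 by rewrite ger0_norm; lra.
have := @cvg_geometric R M _ h => /cvgrPdist_lt/(_ e e0)[N _ /(_ N (leqnn N))].
rewrite sub0r normrN /geometric/= => hN; apply: (le_trans (small N)).
by apply: le_trans (ltW hN); rewrite ler_norm.
Qed.

(** As [X = w v / 2] and [X ^+ 2 = v - 1], odd polynomials in [X] are [w]
    times polynomials in [v]. *)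
Lemma mean_odd_eq0 (p : {poly R}) : mean P (fun t => X t * p.[X t ^+ 2]) = 0.
Proof.
have E : (fun t => X t * p.[X t ^+ 2]) =
    fun t => w t * (2^-1 *: ('X * (p \Po ('X - 1)))).[v t].
  apply/funext => t; rewrite hornerZ hornerM hornerX horner_comp hornerD hornerN hornerX hornerC.
  have -> : v t - 1 = X t ^+ 2 by rewrite /v addrC addKr.
  by rewrite /w /wfun -/(v t); field; rewrite gt_eqF.
rewrite E; apply: mean_horner_eq0 => // j.
rewrite -[RHS](mean_w_horner_v 1 j); congr mean; apply/funext => t.
by rewrite hornerC mulr1.
Qed.

End OddMoments.

Section ReflectionMinimality.
Context d (T : measurableType d) (R : realType) (P : probability T R).
Variables (X : T -> R) (mX : measurable_fun setT X) (A : set T).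
Hypothesis mA : measurable A.
Hypothesis PA : P A = 1%E.
Hypothesis X1 : forall t, A t -> `|X t| <= 1.
Hypothesis EX : (energy P X < +oo)%E.
Hypothesis minX : (energy P X <= reflected_energy P X)%E.

Let Y t := Num.max (-1) (Num.min 1 (X t)).

Let mY : measurable_fun setT Y.
Proof. by apply: measurable_maxr => //; exact: measurable_minr. Qed.

Let YX t : A t -> Y t = X t.
Proof.
move=> /X1; rewrite ler_norml => /andP[a b]; rewrite /Y.
by rewrite (min_idPr b) (max_idPr a).
Qed.

Let Y1 t : `|Y t| <= 1.
Proof.
rewrite /Y ler_norml; apply/andP; split; first by rewrite le_max lexx.
by rewrite ge_max ge_min lexx /=; lra.
Qed.

Let EY : energy P Y = energy P X.
Proof.
apply: (eq_integral_product mA PA).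
- exact: measurable_logk_sub.
- exact: measurable_logk_sub.
- by move=> z; exact: logk_ge0.
- by move=> z; exact: logk_ge0.
by move=> x y Ax Ay; rewrite /= !YX.
Qed.

Let RY : reflected_energy P Y = reflected_energy P X.
Proof.
apply: (eq_integral_product mA PA).
- exact: measurable_logk_add.
- exact: measurable_logk_add.
- by move=> z; exact: logk_ge0.
- by move=> z; exact: logk_ge0.
by move=> x y Ax Ay; rewrite /= !YX.
Qed.

Lemma reflected_energy_eq : reflected_energy P X = energy P X.
Proof.
apply/eqP; rewrite eq_le minX andbT -RY -EY.
have EYf : (energy P Y < +oo)%E by rewrite EY.
apply: le_trans (reflected_energy_gap mY Y1 EYf 0%N).
by rewrite leeDl// lee_fin sqr_ge0.
Qed.

(** By [reflected_energy_gap], minimality leaves no room for nonzero moments.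
    Replacing [X] by its truncation [Y] to [-1, 1], equal to it almost surely,
    makes all functions bounded. *)
Lemma odd_moment_eq0 (p : {poly R}) : mean P (fun t => X t * p.[X t ^+ 2]) = 0.
Proof.
have -> : mean P (fun t => X t * p.[X t ^+ 2]) = mean P (fun t => Y t * p.[Y t ^+ 2]).
  rewrite /mean; congr fine; apply: ae_eq_integral => //.
  - apply/measurable_EFinP; apply: measurable_funM => //.
    apply: (measurableT_comp (f := fun x => p.[x])) => //; last exact: measurable_funX.
    by apply: continuous_measurable_fun; exact: continuous_horner.
  - apply/measurable_EFinP; apply: measurable_funM => //.
    apply: (measurableT_comp (f := fun x => p.[x])) => //; last exact: measurable_funX.
    by apply: continuous_measurable_fun; exact: continuous_horner.
  exists (~` A); split; first exact: measurableC.
    by have := probability_setC P mA; rewrite PA subee.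
  by move=> t /= nE At; apply: nE => _; rewrite YX.
apply: mean_odd_eq0 => // j.
have EYf : (energy P Y < +oo)%E by rewrite EY.
have := reflected_energy_gap mY Y1 EYf j.
rewrite EY RY reflected_energy_eq.
move: (energy_ge0 P X) EX; case: (energy P X) => [a| |]//= a0 _.
rewrite -EFinD lee_fin gerDl => h; apply/eqP; rewrite -sqrf_eq0 eq_le h sqr_ge0//.
Qed.

End ReflectionMinimality.

(** * Self-similarity of the uniform measure *)

Section SelfSimilarity.
Variable R : realType.
Let leb := @lebesgue_measure R.

Section Halving.
Variable c : R.
Let phi : measurableTypeR R -> measurableTypeR R := fun t => (t + c) / 2.
Let mphi : measurable_fun setT phi.
Proof. by apply: measurable_funM => //; exact: measurable_funD. Qed.
Let half : {nonneg R} := (2^-1)%:nng.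
Let m : {measure set (measurableTypeR R) -> \bar R} :=
  mscale half (measure_function_pushforward__canonical__measure_function_Measure leb mphi).

Let mE (A : set R) : measurable A -> leb A = m A.
Proof.
apply: lebesgue_measure_unique => _ [[a b] _ <-] /=.
have pE : (phi : R -> R) @^-1` `]a, b]%classic = `]2 * a - c, 2 * b - c]%classic.
  by apply/seteqP; split => x /=; rewrite !in_itv /= /phi => /andP[h1 h2];
     apply/andP; split; lra.
pose S : set R := `]2 * a - c, 2 * b - c]%classic.
have -> : m `]a, b]%classic = ((2^-1)%:E * leb S)%E by rewrite /S -pE.
have e : (2 * a - c < 2 * b - c) = (a < b) by apply/idP/idP => ?; lra.
rewrite /leb /S !lebesgue_measure_itv /= !lte_fin e.
case: ifP => ab; last by rewrite mule0.
by rewrite -!EFinD -EFinM; congr EFin; field.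
Qed.

(** The image of Lebesgue measure under [t -> (t + c) / 2] is twice Lebesgue
    measure. *)
Lemma ge0_integral_lebesgue_half (h : R -> \bar R) :
  measurable_fun setT h -> (forall x, 0 <= h x)%E ->
  (\int[leb]_t h t = (2^-1)%:E * \int[leb]_t h ((t + c) / 2)%R)%E.
Proof.
move=> mh h0.
transitivity (\int[m]_t h t)%E.
  by apply: eq_measure_integral => A mA _; exact: mE.
by rewrite ge0_integral_mscale// ge0_integral_pushforward.
Qed.

End Halving.

Definition unif : probability (measurableTypeR R) R := uniform_prob (@ltr01 R).

Lemma integral_unif (h : R -> \bar R) :
  measurable_fun setT h -> (forall x, 0 <= h x)%E ->
  (\int[unif]_t h t = \int[leb]_(t in `[0%R, 1%R[) h t)%E.
Proof.
move=> mh h0; rewrite integral_uniform// subr0 invr1 mul1e.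
by rewrite integral_itv_bndo_bndc//; exact: measurable_funTS.
Qed.

Lemma unif_full : unif `[0, 1[%classic = 1%E.
Proof.
have m01 : measurable (`[0, 1[%classic : set R) by [].
have L : leb `[0, 1[%classic = 1%E.
  by rewrite /leb lebesgue_measure_itv /= lte_fin ltr01 -EFinB subr0.
have := @integral_unif (fun x => (\1_`[0, 1[%classic x)%:E).
rewrite integral_indic// setIT => ->.
  rewrite integral_indic// setIid; exact: L.
- by apply/measurable_EFinP; exact: measurable_indic.
- by move=> x; rewrite lee_fin.
Qed.

(** The binary shift: the first digit of a uniform number is a fair coin,
    independent of the following ones. *)
Lemma integral_unif_half (h : R -> \bar R) :
  measurable_fun setT h -> (forall x, 0 <= h x)%E ->
  (\int[unif]_t h t = (2^-1)%:E * \int[unif]_t h (t / 2)%R +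
                      (2^-1)%:E * \int[unif]_t h ((t + 1) / 2)%R)%E.
Proof.
move=> mh h0.
have maff c : measurable_fun setT (fun t : R => h ((t + c) / 2)).
  apply: (measurableT_comp mh); apply: measurable_funM => //.
  exact: measurable_funD.
have piece c (A : set R) : measurable A ->
    (forall t, A ((t + c) / 2) <-> `[0, 1[%classic t) ->
    (\int[leb]_(t in A) h t =
      (2^-1)%:E * \int[leb]_(t in `[0%R, 1%R[) h ((t + c) / 2)%R)%E.
  move=> mA HA; rewrite integral_mkcond (@ge0_integral_lebesgue_half c).
  - rewrite [in RHS]integral_mkcond; congr (_ * _)%E; apply: eq_integral => t _.
    rewrite !patchE; congr (if _ then _ else _).
    by apply/idP/idP; rewrite !inE => /HA.
  - by apply/(measurable_restrictT _ mA); exact: measurable_funTS.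
  - by move=> x; rewrite patchE; case: ifP.
rewrite integral_unif//.
have -> : `[0, 1[%classic = (`[0, 1 / 2[ `|` `[1 / 2, 1[)%classic :> set R.
  apply/seteqP; split => x /=; rewrite !in_itv /=.
    by move=> /andP[x0 x1]; case: (ltP x (1 / 2)) => hx; [left|right]; apply/andP; split; lra.
  by move=> [] /andP[h1 h2]; apply/andP; split; lra.
rewrite ge0_integral_setU//; last 2 first.
- exact: measurable_funTS.
- apply/disj_setPS => x [] /=; rewrite !in_itv /= => /andP[_ a] /andP[b _]; lra.
rewrite (piece 0)//; last first.
  by move=> t /=; rewrite !in_itv /=; split => /andP[a b]; apply/andP; split; lra.
rewrite (piece 1)//; last first.
  by move=> t /=; rewrite !in_itv /=; split => /andP[a b]; apply/andP; split; lra.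
rewrite !integral_unif//; last by have := maff 0; under eq_fun do rewrite addr0.
by congr (_ * _ + _)%E; apply: eq_integral => t _; rewrite addr0.
Qed.

End SelfSimilarity.

(** * Finite energy of the uniform measure *)

Section UniformEnergy.
Local Open Scope ereal_scope.
Variable R : realType.

Let disk (x : R) (k : nat) : set R := `[(x - 2 ^- k)%R, (x + 2 ^- k)%R]%classic.

Let mdisk x k : measurable (disk x k).
Proof. by rewrite /disk. Qed.

(** With [l = - ln |x - y|] the point [y] lies in the disk of radius [2 ^- k]
    for every [k <= l], because [exp 1 >= 2], and there are more than [l] such
    [k]. *)
Lemma logk_layers (x y : R) :
  logk (2 * x - 1 - (2 * y - 1))%R <= \sum_(k <oo) (\1_(disk x k) y)%:E.
Proof.
have F N : (forall k, (k < N)%N -> `|x - y| <= 2 ^- k)%R ->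
    (N%:R : R)%:E <= \sum_(k <oo) (\1_(disk x k) y)%:E.
  move=> H; apply: (@le_trans _ _ (\sum_(0 <= k < N) (\1_(disk x k) y)%:E)); last first.
    by apply: nneseries_lim_ge => n _ _; rewrite lee_fin.

  rewrite sumEFin lee_fin (eq_big_nat _ _ (F2 := fun=> 1%R)).
    by rewrite sumr_const_nat subn0.
  move=> k /andP[_ kN]; rewrite indicE mem_set// /disk /= in_itv /=.
  by have := H k kN; rewrite ler_norml => /andP[h1 h2]; apply/andP; split; lra.
have -> : (2 * x - 1 - (2 * y - 1) = 2 * (x - y))%R by ring.
rewrite /logk mulf_eq0 pnatr_eq0 /=; case: ifPn => [/eqP xy|xy].
  rewrite leye_eq; apply/eqP/eqyP => M M0.
  apply: (@le_trans _ _ ((Num.truncn M).+1%:R : R)%:E).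
    by rewrite lee_fin ltW//; have /andP[] := truncn_itv (ltW M0).
  by apply: F => k _; rewrite xy normr0 invr_ge0 exprn_ge0.
rewrite normrM (@gtr0_norm _ 2%R)// mulrC mulKf ?pnatr_eq0//.
have u0 : (0 < `|x - y|)%R by rewrite normr_gt0.
have [l0|l0] := leP (- ln `|x - y|)%R 0%R.
  by apply: nneseries_ge0 => k _ _.
set l := (- ln `|x - y|)%R in l0 *.
apply: (@le_trans _ _ ((Num.truncn l).+1%:R : R)%:E).
  by rewrite lee_fin ltW//; have /andP[] := truncn_itv (ltW l0).
apply: F => k kl.
have kle : (k%:R <= l :> R)%R.
  by apply: le_trans (proj1 (andP (truncn_itv (ltW l0)))); rewrite ler_nat -ltnS.
rewrite -[`|x - y|%R]lnK ?posrE// -[ln _]opprK -/l.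
apply: (@le_trans _ _ (expR (- k%:R))); first by rewrite ler_expR lerN2.
rewrite expRN lef_pV2 ?posrE ?expR_gt0 ?exprn_gt0//.
rewrite -[k%:R]mulr1 expRM_natl lerXn2r ?nnegrE ?expR_ge0//.
by have := @expR_ge1Dx R 1%R; lra.
Qed.

Lemma unif_disk x k : unif R (disk x k) <= (2 * 2 ^- k)%:E.
Proof.
have md : measurable (disk x k) by rewrite /disk.
have -> : unif R (disk x k) = \int[unif R]_y (\1_(disk x k) y)%:E.
  by rewrite integral_indic// setIT.
rewrite integral_unif//; last by apply/measurable_EFinP; apply: measurable_indic; exact: mdisk.
rewrite integral_indic//.
apply: (@le_trans _ _ (lebesgue_measure (disk x k))).
  by apply: le_measure; rewrite ?inE//; exact: measurableI.
have p : (0 < 2 ^- k :> R)%R by rewrite invr_gt0 exprn_gt0.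
rewrite /disk lebesgue_measure_itv /= lte_fin ifT; last lra.
by rewrite -EFinB lee_fin; lra.
Qed.

(** Summing the layers, the potential of the uniform measure is at most the
    sum of the lengths [2 * 2 ^- k]. *)
Lemma energy_unif : energy (unif R) (fun t => 2 * t - 1)%R < +oo.
Proof.
have ma : measurable_fun [set: R] (fun t : R => 2 * t - 1)%R.
  by apply: measurable_funB => //; exact: measurable_funM.
rewrite energyE//.
have inner x : \int[unif R]_y logk (2 * x - 1 - (2 * y - 1))%R <= 4%:E.
  apply: (@le_trans _ _ (\int[unif R]_y \sum_(k <oo) (\1_(disk x k) y)%:E)).
    apply: ge0_le_integral => //.
    - by move=> y _; exact: logk_ge0.
    - apply: (measurableT_comp (@measurable_logk R)).
      exact: measurable_funB.
    - apply: ge0_emeasurable_sum => [k z _ _|k _]; first by rewrite lee_fin.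
      by apply/measurable_EFinP; apply: measurable_indic; exact: mdisk.
    - by move=> y _; exact: logk_layers.
  rewrite integral_nneseries//; last first.
    by move=> k; apply/measurable_EFinP; apply: measurable_indic; exact: mdisk.
  apply: lime_le; first by apply: is_cvg_nneseries => k _ _; exact: integral_ge0.
  apply: nearW => n; apply: (@le_trans _ _ (\sum_(0 <= k < n) (2 * 2 ^- k)%:E)).
    by apply: lee_sum => k _; rewrite integral_indic ?setIT ?unif_disk//; exact: mdisk.
  rewrite sumEFin lee_fin.
  suff -> : (\sum_(0 <= k < n) 2 * 2 ^- k = 4 - 4 * 2 ^- n :> R)%R.
    by rewrite gerBl mulr_ge0// invr_ge0 exprn_ge0.
  elim: n => [|n IH]; first by rewrite big_geq// expr0 invr1; ring.
  by rewrite big_nat_recr//= IH exprS; field; rewrite expf_neq0.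
apply: (@le_lt_trans _ _ (\int[unif R]_x 4%:E)).
  apply: ge0_le_integral => //.
  - by move=> x _; apply: integral_ge0 => y _; exact: logk_ge0.
  - have H := @measurable_fun_fubini_tonelli_F _ _ _ _ R (unif R)
      (fun z : measurableTypeR R * measurableTypeR R => logk (2 * z.1 - 1 - (2 * z.2 - 1))%R).
    apply: H; first exact: (@measurable_logk_sub _ _ _ (fun t : measurableTypeR R => 2 * t - 1)%R).
    by move=> z; exact: logk_ge0.
have UT : unif R setT = 1 by exact: probability_setT.
by rewrite integral_cst// [X in _ * X]UT mule1 ltry.
Qed.

End UniformEnergy.

(** * Contraction of the inverse branches *)

Section InverseBranches.
Variable R : realType.
Implicit Types (g y x t : R) (sigma : nat -> R).

(** The nonnegative solution [x] of [quad g x = y]. *)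
Definition branch g y : R := Num.sqrt (1 - 2 * g * (1 - y)).

Lemma branch_arg_ge0 g y : 0 < g < 1 / 4 -> `|y| <= 1 -> 0 <= 1 - 2 * g * (1 - y).
Proof. by move=> /andP[g0 g4]; rewrite ler_norml => /andP[y1 y2]; nra. Qed.

Lemma branch_sqr g y : 0 < g < 1 / 4 -> `|y| <= 1 ->
  branch g y ^+ 2 = 1 - 2 * g * (1 - y).
Proof. by move=> hg hy; rewrite /branch sqr_sqrtr// branch_arg_ge0. Qed.

Lemma branch_ge0 g y : 0 <= branch g y.
Proof. exact: sqrtr_ge0. Qed.

Lemma branch_le1 g y : 0 < g < 1 / 4 -> `|y| <= 1 -> branch g y <= 1.
Proof.
move=> hg hy; have b2 := branch_sqr hg hy; have b0 := branch_ge0 g y.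
case/andP: hg => g0 g4; move: hy; rewrite ler_norml => /andP[y1 y2]; nra.
Qed.

Lemma quad_branch g y : 0 < g < 1 / 4 -> `|y| <= 1 -> quad g (branch g y) = y.
Proof.
move=> hg hy; rewrite /quad branch_sqr//; field.
by case/andP: hg => g0 _; rewrite gt_eqF.
Qed.

Lemma quadN g y : quad g (- y) = quad g y.
Proof. by rewrite /quad sqrrN. Qed.

Lemma sin_mono (a b : R) : 0 <= a -> b <= pi / 2 -> a <= pi / 2 -> 0 <= b ->
  sin a <= sin b -> a <= b.
Proof.
move=> a0 bp ap b0; apply: contra_le => ba; rewrite ltr_sin// in_itv /=.
  by apply/andP; split; [have := @pi_gt0 R; lra|].
by apply/andP; split; [have := @pi_gt0 R; lra|].
Qed.

Lemma sin_sub_sin (a b : R) : sin a - sin b = 2 * cos ((a + b) / 2) * sin ((a - b) / 2).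
Proof.
have -> : a = (a + b) / 2 + (a - b) / 2 by field.
set p := (a + b) / 2; set q := (a - b) / 2.
have -> : b = p - q by rewrite /p /q; field.
have -> : (p + q + (p - q)) / 2 = p by field.
have -> : (p + q - (p - q)) / 2 = q by field.
by rewrite sinD sinB; ring.
Qed.

(** With [cos (2 p) = y] and [cos f] the value of the branch, the quadratic
    map reads [sin f = sqrt (4 g) * sin p]. *)
Lemma acos_branch g y : 0 < g < 1 / 4 -> `|y| <= 1 ->
  [/\ 0 <= acos (branch g y) <= pi / 2, 0 <= acos y / 2 <= pi / 2 &
      sin (acos (branch g y)) = Num.sqrt (4 * g) * sin (acos y / 2)].
Proof.
move=> hg hy.
have hy' : -1 <= y <= 1 by rewrite -ler_norml.
have b0 := branch_ge0 g y; have b1 := branch_le1 hg hy; have b2 := branch_sqr hg hy.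
have hb : -1 <= branch g y <= 1 by apply/andP; split; lra.
have pi0 := @pi_gt0 R.
have y0 := acos_ge0 hy'; have y1 := acos_lepi hy'.
split.
- rewrite acos_ge0//= leNgt; apply/negP => h.
  have : cos (acos (branch g y)) < cos (pi / 2).
    rewrite ltr_cos// in_itv /= ?acos_ge0 ?acos_lepi//.
    by apply/andP; split; lra.
  by rewrite cos_pihalf acosK ?in_itv//= ltNge b0.
- by apply/andP; split; lra.
have s0 : 0 <= sin (acos y / 2) by apply: sin_ge0_pi; apply/andP; split; lra.
rewrite sin_acos// b2 -[sin (acos y / 2)]ger0_norm// -sqrtr_sqr -sqrtrM; last first.
  by case/andP: hg => g0 _; lra.
congr Num.sqrt.
have cy : cos (acos y) = y by rewrite acosK// in_itv.
have : cos ((acos y / 2) *+ 2) = y.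
  by rewrite -{}[RHS]cy; congr cos; rewrite -mulr_natr divfK.
rewrite cos_mulr2n -mulr_natl cos2sin2 => e.
have e' : 1 - y = 2 * sin (acos y / 2) ^+ 2 by lra.
by rewrite e'; ring.
Qed.

(** Write [f], [f'] for the angles of the images and [p], [p'] for half the
    angles of the arguments, so [sin f = c sin p] with [c <= 1], and [f <= p],
    [f' <= p']. By the formula for differences of sines, [f - f' > p - p']
    would contradict [sin f - sin f' = c (sin p - sin p')]. In the angle,
    inverse branches thus contract by 1/2, uniformly in [g < 1 / 4], although
    the square root is not Lipschitz. *)
Lemma acos_branch_contract_lt g y y' : 0 < g < 1 / 4 -> `|y| <= 1 -> `|y'| <= 1 ->
  acos y' < acos y ->
  0 <= acos (branch g y) - acos (branch g y') <= (acos y - acos y') / 2.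
Proof.
move=> hg hy hy' yy.
have [/andP[f0 f1] /andP[p0 p1] fp] := acos_branch hg hy.
have [/andP[f0' f1'] /andP[p0' p1'] fp'] := acos_branch hg hy'.
set f := acos (branch g y) in f0 f1 fp *.
set f' := acos (branch g y') in f0' f1' fp' *.
set p := acos y / 2 in p0 p1 fp *; set p' := acos y' / 2 in p0' p1' fp' *.
have pp : p' < p by rewrite /p /p'; lra.
have -> : (acos y - acos y') / 2 = p - p' by rewrite /p /p'; field.
set c := Num.sqrt (4 * g) in fp fp'.
have c0 : 0 <= c by rewrite sqrtr_ge0.
have c1 : c <= 1.
  case/andP: hg => g0 g4; rewrite -sqrtr1 ler_sqrt//; lra.
have pi0 := @pi_gt0 R.
have sle (q : R) : 0 <= q <= pi / 2 -> 0 <= sin q.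
  by move=> /andP[q0 q1]; apply: sin_ge0_pi; apply/andP; split; lra.
have sp : 0 <= sin p by apply: sle; rewrite p0.
have sp' : 0 <= sin p' by apply: sle; rewrite p0'.
have spp : sin p' < sin p.
  by rewrite ltr_sin// in_itv /=; apply/andP; split; lra.
have fle : f <= p by apply: sin_mono => //; rewrite fp; nra.
have fle' : f' <= p' by apply: sin_mono => //; rewrite fp'; nra.
have ff : f' <= f by apply: sin_mono => //; rewrite fp fp' ler_wpM2l// ltW.
rewrite subr_ge0 ff /= leNgt; apply/negP => h.
have cos_mono (a b : R) : 0 <= a -> a <= b -> b <= pi / 2 -> cos b <= cos a.
  move=> a0 ab bp; rewrite leNgt; apply/negP.
  rewrite ltr_cos ?in_itv /=; first by rewrite ltNge ab.
    by apply/andP; split; lra.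
  by apply/andP; split; lra.
have e1 := sin_sub_sin f f'; have e2 := sin_sub_sin p p'.
(* Positive since [p' < p <= pi / 2] excludes [p + p' = pi]. *)
have cB : 0 < cos ((p + p') / 2) by apply: cos_gt0_pihalf; apply/andP; split; lra.
have cb : cos ((p + p') / 2) <= cos ((f + f') / 2) by apply: cos_mono; lra.
have sa : sin ((p - p') / 2) < sin ((f - f') / 2).
  by rewrite ltr_sin ?in_itv /=; try (apply/andP; split); lra.
have s0 : 0 <= sin ((p - p') / 2) by apply: sle; apply/andP; split; lra.
have e3 : sin f - sin f' = c * (sin p - sin p') by rewrite fp fp'; ring.
move: e3; rewrite e1 e2.
set S := sin ((p - p') / 2) in sa s0 *; set S' := sin ((f - f') / 2) in sa *.
set C := cos ((p + p') / 2) in cB cb *; set C' := cos ((f + f') / 2) in cb *.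
move=> e3.
have h1 : C * S < C' * S'.
  apply: (@lt_le_trans _ _ (C * S')); first by rewrite ltr_pM2l.
  by rewrite ler_wpM2r// ltW// (le_lt_trans s0).
have h2 : c * (C * S) <= C * S by rewrite ler_piMl// mulr_ge0// ltW.
by lra.
Qed.

Lemma acos_branch_contract g y y' : 0 < g < 1 / 4 -> `|y| <= 1 -> `|y'| <= 1 ->
  `|acos (branch g y) - acos (branch g y')| <= `|acos y - acos y'| / 2.
Proof.
move=> hg hy hy'; case: (ltgtP (acos y) (acos y')) => h.
- have /andP[a b] := acos_branch_contract_lt hg hy' hy h.
  by rewrite distrC [X in _ <= X / 2]distrC !ger0_norm//; lra.
- have /andP[a b] := acos_branch_contract_lt hg hy hy' h.
  by rewrite !ger0_norm//; lra.
have -> : y = y'.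
  have := congr1 cos h; rewrite !acosK// in_itv /= -ler_norml//.
by rewrite !subrr !normr0 mul0r.
Qed.

End InverseBranches.

(** * Coding of the Cantor set by binary digits *)

Section CantorCoding.
Variable R : realType.
Implicit Types (t x y : R) (sigma : nat -> R).

Definition tail_seq sigma : nat -> R := fun k => sigma k.+1.

(** Steps and parameters are counted from 0, so that forgetting the first step
    amounts to [tail_seq]. *)
Fixpoint qiter sigma (k : nat) (x : R) : R :=
  if k is j.+1 then quad (sigma j) (qiter sigma j x) else x.

Definition cantor_set sigma : set R := [set x | forall k, `|qiter sigma k x| <= 1].

(** The [k]-th binary digit of [t] selects the sign of the [k]-th inverse
    branch; after [n] digits the remaining ones enter as a uniform point of
    [-1, 1]. The truncation to [-1, 1] only concerns arguments outside the
    unit interval. *)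
Fixpoint coding (n : nat) sigma t : R :=
  if n is m.+1 then
    if t < 1 / 2 then - branch (sigma 0%N) (coding m (tail_seq sigma) (2 * t))
    else branch (sigma 0%N) (coding m (tail_seq sigma) (2 * t - 1))
  else Num.max (-1) (Num.min 1 (2 * t - 1)).

Definition admissible sigma : Prop := forall k, 0 < sigma k < 1 / 4.

Lemma admissible_tail sigma : admissible sigma -> admissible (tail_seq sigma).
Proof. by move=> h k; exact: h. Qed.

Lemma qiterS sigma k x :
  qiter sigma k.+1 x = qiter (tail_seq sigma) k (quad (sigma 0%N) x).
Proof. by elim: k => //= k <-. Qed.

Lemma cantor_setP sigma x : cantor_set sigma x <->
  `|x| <= 1 /\ cantor_set (tail_seq sigma) (quad (sigma 0%N) x).
Proof.
split=> [h|[h0 h] [|k]]; [|by []|by rewrite qiterS; exact: h].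
by split; [exact: (h 0%N)|move=> k; rewrite -qiterS; exact: h].
Qed.

Lemma coding_bound n sigma t : admissible sigma -> `|coding n sigma t| <= 1.
Proof.
elim: n sigma t => [|n IH] sigma t hs /=.
  rewrite ler_norml; apply/andP; split; first by rewrite le_max lexx.
  by rewrite ge_max ge_min lexx /=; lra.
have b s : `|branch (sigma 0%N) (coding n (tail_seq sigma) s)| <= 1.
  rewrite ger0_norm ?branch_ge0//; apply: branch_le1 => //.
  by apply: IH; exact: admissible_tail.
by case: ifP => _; rewrite ?normrN b.
Qed.

Lemma quad_coding n sigma t : admissible sigma ->
  quad (sigma 0%N) (coding n.+1 sigma t) =
  coding n (tail_seq sigma) (if t < 1 / 2 then 2 * t else 2 * t - 1).
Proof.
move=> hs /=; case: ifP => _; rewrite ?quadN quad_branch//;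
  by apply: coding_bound; exact: admissible_tail.
Qed.

Lemma qiter_coding n sigma k t : admissible sigma -> (k <= n)%N ->
  `|qiter sigma k (coding n sigma t)| <= 1.
Proof.
elim: k n sigma t => [|k IH] [|n] sigma t hs kn //; try exact: coding_bound.
by rewrite qiterS quad_coding//; apply: IH => //; exact: admissible_tail.
Qed.

(** Both points are images under the same [n] inverse branches, each of which
    contracts the angle by 1/2. *)
Lemma coding_acos n m sigma t : admissible sigma -> (n <= m)%N ->
  `|acos (coding n sigma t) - acos (coding m sigma t)| <= pi / 2 ^+ n.
Proof.
elim: n m sigma t => [|n IH] m sigma t hs nm.
  have b k : -1 <= coding k sigma t <= 1 by rewrite -ler_norml coding_bound.
  have := acos_ge0 (b 0%N); have := acos_lepi (b 0%N).
  have := acos_ge0 (b m); have := acos_lepi (b m).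
  by rewrite expr0 divr1 ler_norml => *; apply/andP; split; lra.
case: m nm => // m nm.
have hs' := admissible_tail hs.
have step s : `|acos (branch (sigma 0%N) (coding n (tail_seq sigma) s)) -
    acos (branch (sigma 0%N) (coding m (tail_seq sigma) s))| <= pi / 2 ^+ n.+1.
  apply: (le_trans (acos_branch_contract (hs 0%N) (coding_bound n s hs') (coding_bound m s hs'))).
  by rewrite exprSr invfM mulrA ler_pM2r ?invr_gt0// IH.
rewrite /=; case: ifP => _; last exact: step.
have b k s : -1 <= branch (sigma 0%N) (coding k (tail_seq sigma) s) <= 1.
  rewrite -ler_norml ger0_norm ?branch_ge0//; apply: branch_le1 => //.
  exact: coding_bound.
rewrite !acosN// opprB addrC subrKA -normrN opprB; exact: step.
Qed.

Lemma cos_lipschitz x y : `|cos x - cos y| <= `|x - y|.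
Proof.
wlog xy : x y / x <= y.
  by move=> h; case: (leP x y) => [/h//|/ltW /h]; rewrite distrC [X in _ <= X]distrC.
have [|c _] := @MVT_segment R cos (- sin) x y xy (fun z _ => is_derive_cos z).
  by apply: continuous_subspaceT => z; exact: continuous_cos.
rewrite distrC [X in _ <= X]distrC => ->; rewrite normrM ler_piMl//.
by rewrite normrN; exact: sin_max.
Qed.

Lemma coding_cauchy n m sigma t : admissible sigma -> (n <= m)%N ->
  `|coding n sigma t - coding m sigma t| <= pi / 2 ^+ n.
Proof.
move=> hs nm; apply: le_trans (coding_acos t hs nm).
apply: le_trans (cos_lipschitz _ _).
by rewrite !acosK// in_itv /= -ler_norml coding_bound.
Qed.

Lemma coding_is_cvg sigma t : admissible sigma ->
  cvgn (fun n => coding n sigma t).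
Proof.
move=> hs; apply/cauchy_cvgP/cauchy_exP => e e0.
have h : `|(1 / 2 : R)| < 1 by rewrite ger0_norm; lra.
have := @cvg_geometric R pi _ h => /cvgrPdist_lt/(_ e e0)[N _ /(_ N (leqnn N))].
rewrite sub0r normrN /geometric/= => hN.
exists (coding N sigma t); exists N => // m /= Nm.
rewrite /ball /=; apply: (le_lt_trans (coding_cauchy t hs Nm)).
by apply: le_lt_trans hN; rewrite mul1r exprVn ler_norm.
Qed.

Definition coding_limit sigma t : R := limn (fun n => coding n sigma t).

Lemma coding_cvg sigma t : admissible sigma ->
  (fun n => coding n sigma t) @ \oo --> coding_limit sigma t.
Proof. by move=> hs; exact: coding_is_cvg. Qed.

Lemma quad_continuous g : continuous (@quad R g).
Proof.
move=> x; apply: cvgD; last exact: cvg_cst.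
apply: cvgM; last exact: cvg_cst.
by apply: cvgB; [exact: exprn_continuous|exact: cvg_cst].
Qed.

Lemma qiter_continuous sigma k : continuous (qiter sigma k).
Proof.
elim: k => [|k IH] x; first exact: cvg_id.
by apply: (continuous_comp (IH x)); exact: quad_continuous.
Qed.

Lemma coding_limit_cantor sigma t : admissible sigma ->
  cantor_set sigma (coding_limit sigma t).
Proof.
move=> hs k.
have c1 : (fun n => `|qiter sigma k (coding n sigma t)|) @ \oo -->
    `|qiter sigma k (coding_limit sigma t)|.
  apply: cvg_norm; apply: continuous_cvg; first exact: qiter_continuous.
  exact: coding_cvg.
rewrite -(cvg_lim (@Rhausdorff R) c1); apply: limr_le; first by apply/cvg_ex; eexists; exact: c1.
by exists k => // n /= kn; exact: qiter_coding.
Qed.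

Lemma measurable_branch g : measurable_fun [set: R] (@branch R g).
Proof.
apply: (measurableT_comp (f := @Num.sqrt R)).
  by apply: continuous_measurable_fun; exact: sqrt_continuous.
apply: measurable_funB => //; apply: measurable_funM => //.
exact: measurable_funB.
Qed.

Lemma measurable_coding n sigma : measurable_fun [set: R] (coding n sigma).
Proof.
elim: n sigma => [|n IH] sigma /=.
  apply: measurable_maxr => //; apply: measurable_minr => //.
  by apply: measurable_funB => //; exact: measurable_funM.
apply: measurable_fun_ifT.
- exact: measurable_fun_ltr.
- apply: measurableT_comp => //; apply: (measurableT_comp (@measurable_branch _)).
  by apply: (measurableT_comp (IH _)); exact: measurable_funM.
apply: (measurableT_comp (@measurable_branch _)).
by apply: (measurableT_comp (IH _)); apply: measurable_funB => //; exact: measurable_funM.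
Qed.

Lemma measurable_coding_limit sigma : admissible sigma ->
  measurable_fun [set: R] (coding_limit sigma).
Proof.
move=> hs; apply: (measurable_fun_cvg (h := fun n => coding n sigma)).
  by move=> n; exact: measurable_coding.
by move=> t _; exact: coding_cvg.
Qed.

Lemma measurable_cantor_set sigma : measurable (cantor_set sigma).
Proof.
have -> : cantor_set sigma =
    \bigcap_k ((qiter sigma k) @^-1` `[-1, 1]%classic).
  apply/seteqP; split => x /= h k; first by move=> _; rewrite /= in_itv /= -ler_norml; exact: h.
  by have := h k I; rewrite /= in_itv /= -ler_norml.
apply: bigcapT_measurable => k; rewrite -[X in measurable X]setTI.
have mq : measurable_fun [set: R] (qiter sigma k).
  by apply: continuous_measurable_fun; exact: qiter_continuous.
exact: mq.
Qed.

End CantorCoding.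

(** * A measure of finite energy on the Cantor set *)

Section EnergyOfLaw.
Local Open Scope ereal_scope.
Context d (T : measurableType d) (R : realType) (P : probability T R).
Variables (X : T -> R) (mX : measurable_fun setT X).
Variable S : probability (measurableTypeR R) R.

Lemma energy_law :
  (forall f : R -> \bar R, measurable_fun setT f -> (forall x, 0 <= f x) ->
    \int[P]_t f (X t) = \int[S]_x f x) ->
  energy P X = energy S id.
Proof.
move=> law.
have mid : measurable_fun [set: measurableTypeR R] (fun x : measurableTypeR R => x : R).
  exact: measurable_id.
rewrite (energyE P mX) (energyE S mid).
have mF : measurable_fun setT (fun x : measurableTypeR R => \int[S]_y logk (x - y)).
  apply: (@measurable_fun_fubini_tonelli_F _ _ _ (measurableTypeR R) R S
    (fun z : measurableTypeR R * measurableTypeR R => logk (z.1 - z.2))).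
    exact: (measurable_logk_sub mid).
  by move=> z; exact: logk_ge0.
rewrite -(law (fun x => \int[S]_y logk (x - y))) //; last first.
  by move=> x; apply: integral_ge0 => y _; exact: logk_ge0.
apply: eq_integral => x _; apply: (law (fun y => logk (X x - y))).
  by apply: (measurableT_comp (@measurable_logk R)); exact: measurable_funB.
by move=> y; exact: logk_ge0.
Qed.

End EnergyOfLaw.

Section CantorEnergy.
Local Open Scope ereal_scope.
Variable R : realType.
Implicit Types sigma : nat -> R.

Lemma energy_coding0 sigma : energy (unif R) (coding 0 sigma) < +oo.
Proof.
apply: le_lt_trans (energy_unif R).
have m01 : measurable (`[0%R, 1%R[%classic : set R) by [].
apply: (@le_integral_product _ (measurableTypeR R) R (unif R) `[0%R, 1%R[%classic).
- exact: m01.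
- exact: unif_full.
- exact: (@measurable_logk_sub _ (measurableTypeR R) R _ (measurable_coding 0 sigma)).
- apply: (@measurable_logk_sub _ (measurableTypeR R) R (fun t => 2 * t - 1)%R).
  by apply: measurable_funB => //; exact: measurable_funM.
- by move=> z; exact: logk_ge0.
- by move=> z; exact: logk_ge0.
move=> x y; rewrite /= !in_itv /= => /andP[x0 x1] /andP[y0 y1].
have E (t : R) : (0 <= t)%R -> (t < 1)%R -> Num.max (-1)%R (Num.min 1 (2 * t - 1))%R = (2 * t - 1)%R.
  move=> t0 t1; have h1 : (2 * t - 1 <= 1)%R by lra.
  have h2 : (-1 <= 2 * t - 1)%R by lra.
  by rewrite (min_idPr h1) (max_idPr h2).
by rewrite !E.
Qed.

Lemma energy_coding_finite_base : exists e0 : R, (0 <= e0)%R /\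
  forall sigma, energy (unif R) (coding 0 sigma) = e0%:E.
Proof.
have := energy_coding0 (fun=> 0%R); have := energy_ge0 (unif R) (coding 0 (fun=> 0%R)).
case E : (energy (unif R) (coding 0 (fun=> 0%R))) => [e| |]// e0 _.
by exists e; split=> // sigma; rewrite -E.
Qed.

(** By the binary shift, the law of [coding n.+1] is the symmetrization of the
    branch applied to [coding n] for the remaining parameters. The quadratic
    map undoes the branch, so the energy identity applies. *)
Lemma energy_codingS n sigma : admissible sigma ->
  energy (unif R) (coding n.+1 sigma) =
  (2^-1)%:E * (energy (unif R) (coding n (tail_seq sigma)) + (- ln (sigma 0%N))%:E).
Proof.
move=> hs; have hs' := admissible_tail hs.
pose b (t : measurableTypeR R) := branch (sigma 0%N) (coding n (tail_seq sigma) t).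
have mb : measurable_fun setT b.
  by apply: (measurableT_comp (@measurable_branch R _)); exact: measurable_coding.
rewrite (@energy_law _ (measurableTypeR R) R (unif R) _ (measurable_coding n.+1 sigma) (symmetrized (unif R) mb)).
  rewrite [LHS](energy_symmetrized (unif R) mb) -muleDr; last 2 first.
  - by [].
  - by rewrite ge0_adde_def ?inE ?energy_ge0 ?reflected_energy_ge0.
  congr (_ * _).
  have /andP[s0 s4] := hs 0%N.
  apply: (energy_add_reflected mb (measurable_coding n (tail_seq sigma)) (g := sigma 0%N) (A := setT)) => //.
  - by rewrite s0; lra.
  - exact: probability_setT.
  move=> t _; split; last by rewrite quad_branch//; exact: coding_bound.
    by rewrite ger0_norm ?branch_ge0// branch_le1//; exact: coding_bound.
  exact: coding_bound.
move=> f mf f0; rewrite ge0_integral_symmetrized//.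
have mc : measurable_fun setT (fun t => f (coding n.+1 sigma t)).
  by apply: (measurableT_comp mf); exact: measurable_coding.
rewrite integral_unif_half// addeC.
have mfb : measurable_fun [set: R] (fun t => f (b t)).
  exact: (measurableT_comp mf).
have mfNb : measurable_fun [set: R] (fun t => f (- b t)%R).
  by apply: (measurableT_comp mf); exact: measurableT_comp.
have maff (c : R) : measurable_fun [set: R] (fun t : R => (t + c) / 2)%R.
  by apply: measurable_funM => //; exact: measurable_funD.
have mc1 : measurable_fun [set: R] (fun t : R => f (coding n.+1 sigma ((t + 1) / 2)%R)).
  exact: (measurableT_comp mc (maff 1%R)).
have mc0 : measurable_fun [set: R] (fun t : R => f (coding n.+1 sigma (t / 2)%R)).
  have := measurableT_comp mc (maff 0%R); congr (measurable_fun _ _).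
  by apply/funext => t /=; rewrite addr0.
congr (_ * _ + _ * _); rewrite !integral_unif//; apply: eq_integral => t.
  rewrite inE /= in_itv /= => /andP[t0 t1].
  have -> : ((t + 1) / 2 < 1 / 2)%R = false by apply/negbTE; rewrite -leNgt; lra.
  by congr (f (branch _ (coding _ _ _))); field.
rewrite inE /= in_itv /= => /andP[t0 t1].
have -> : (t / 2 < 1 / 2)%R by lra.
by congr (f (- branch _ (coding _ _ _)))%R; field.
Qed.

Lemma energy_coding_le n sigma (e0 : R) : admissible sigma -> (0 <= e0)%R ->
  (forall tau, energy (unif R) (coding 0 tau) = e0%:E) ->
  energy (unif R) (coding n sigma) <=
    (\sum_(k < n) 2 ^- k.+1 * - ln (sigma k) + e0)%:E.
Proof.
move=> hs e00 E0; elim: n sigma hs => [|n IH] sigma hs.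
  by rewrite big_ord0 add0r E0.
rewrite energy_codingS//.
apply: (@le_trans _ _ ((2^-1)%:E * ((\sum_(k < n) 2 ^- k.+1 * - ln (tail_seq sigma k) + e0)%:E
    + (- ln (sigma 0%N))%:E))).
  by rewrite lee_pmul2l ?leeD2r ?IH ?lte_fin ?invr_gt0//; exact: admissible_tail.
have -> : (\sum_(k < n.+1) 2 ^- k.+1 * - ln (sigma k) =
    2^-1 * - ln (sigma 0%N) + 2^-1 * \sum_(k < n) 2 ^- k.+1 * - ln (tail_seq sigma k))%R.
  rewrite big_ord_recl expr1 mulr_sumr; congr (_ + _)%R; apply: eq_bigr => k _.
  by rewrite lift0 exprS invfM mulrA.
by rewrite -EFinD -EFinM lee_fin; lra.
Qed.

Lemma logk_gt (K u : R) : (0 < K)%R ->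
  (K%:E < logk u) = (`|u| < 2 * expR (- K))%R /\
  (K%:E <= logk u) = (`|u| <= 2 * expR (- K))%R.
Proof.
move=> K0; rewrite /logk; case: ifPn => [/eqP ->|u0].
  rewrite normr0 ltry leey mulr_gt0 ?expR_gt0// mulr_ge0 ?expR_ge0//.
have n0 : (0 < `|u| / 2)%R by rewrite divr_gt0 ?normr_gt0.
have E1 : (`|u| < 2 * expR (- K))%R = (ln (`|u| / 2) < - K)%R.
  by rewrite -[in RHS](expRK (- K)%R) ltr_ln ?posrE ?expR_gt0// ltr_pdivrMr// mulrC.
have E2 : (`|u| <= 2 * expR (- K))%R = (ln (`|u| / 2) <= - K)%R.
  by rewrite -[in RHS](expRK (- K)%R) ler_ln ?posrE ?expR_gt0// ler_pdivrMr// mulrC.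
rewrite E1 E2 lte_fin lee_fin lt_max le_max ltNge (ltW K0) leNgt K0 /=.
by rewrite ltrNr lerNr.
Qed.

Lemma logk_lsc (u_ : nat -> R) (u : R) : u_ @ \oo --> u ->
  logk u <= limn_einf (fun n => logk (u_ n)).
Proof.
move=> uu; apply: le_limn_einf => K hK.
have [K0|K0] := leP K 0%R.
  by apply: nearW => n; apply: (@le_trans _ _ 0); [rewrite lee_fin|exact: logk_ge0].
move: hK; rewrite (logk_gt u K0).1 => hK.
have nu : (fun n => `|u_ n|%R) @ \oo --> `|u|%R by exact: cvg_norm.
have Hn : \forall n \near \oo, (`|u_ n| < 2 * expR (- K))%R.
  by apply: (cvgr_lt _ nu).
apply: filterS Hn => n h.
by rewrite (logk_gt (u_ n) K0).2 ltW.
Qed.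

(** The law of the limit of the codings. The energies of the approximations
    are bounded by [energy_coding_le], and the kernel is lower semicontinuous,
    so Fatou bounds the energy of the limit. *)
Theorem cantor_set_finite_energy sigma (C : R) : admissible sigma ->
  (forall n, \sum_(k < n) 2 ^- k.+1 * - ln (sigma k) <= C)%R ->
  exists nu : probability (measurableTypeR R) R,
    nu (cantor_set sigma) = 1 /\ energy nu id < +oo.
Proof.
move=> hs hC.
pose X : measurableTypeR R -> measurableTypeR R := coding_limit sigma.
have mX : measurable_fun setT X by exact: measurable_coding_limit.
pose mfX : {mfun measurableTypeR R >-> measurableTypeR R} :=
  HB.pack_for {mfun measurableTypeR R >-> measurableTypeR R} X
    (isMeasurableFun.Build _ _ (measurableTypeR R) (measurableTypeR R) X mX).
pose nu : probability (measurableTypeR R) R := distribution (unif R) mfX.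
exists nu; split.
  have -> : nu (cantor_set sigma) = unif R setT.
    rewrite /nu /distribution /pushforward; congr (unif R _).
    by apply/seteqP; split => // t _ /=; exact: coding_limit_cantor.
  exact: probability_setT.
have [e0 [e00 E0]] := energy_coding_finite_base.
rewrite -(@energy_law _ (measurableTypeR R) R (unif R) X mX nu); last first.
  by move=> f mf f0; rewrite ge0_integral_distribution.
apply: (@le_lt_trans _ _ (C + e0)%:E); last exact: ltry.
have mn n : measurable_fun setT (fun z : measurableTypeR R * measurableTypeR R =>
    logk (coding n sigma z.1 - coding n sigma z.2)).
  exact: (@measurable_logk_sub _ (measurableTypeR R) R _ (measurable_coding n sigma)).
have H n : \int[unif R \x unif R]_z logk (coding n sigma z.1 - coding n sigma z.2) <= (C + e0)%:E.
  apply: le_trans (energy_coding_le n hs e00 E0) _.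
  by rewrite lee_fin lerD2r.
apply: le_trans (limn_einf_le_bound H).
apply: le_trans (fatou (unif R \x unif R) measurableT mn _); last by move=> n z _; exact: logk_ge0.
apply: ge0_le_integral => //.
- by move=> z _; exact: logk_ge0.
- exact: (@measurable_logk_sub _ (measurableTypeR R) R _ mX).
- apply: (emeasurable_fun_cvg (fun n z => einfs (fun m => logk (coding m sigma z.1 - coding m sigma z.2)) n)) => [n|z _].
    exact: (measurable_fun_einfs mn).
  by rewrite limn_einf_lim; exact: is_cvg_einfs.
move=> z _; apply: logk_lsc.
by apply: cvgB; exact: coding_cvg.
Qed.

End CantorEnergy.

(** * The equilibrium measure along the dynamics *)

Section LogEnergy.
Local Open Scope ereal_scope.
Variable R : realType.

(** For a kernel of variable sign, the integrals of its positive and negative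
    parts are measurable separately. *)
Lemma measurable_partial_integral d d' (T : measurableType d)
    (U : measurableType d') (P : probability U R) (f : T * U -> \bar R) :
  measurable_fun setT f -> measurable_fun setT (fun x => \int[P]_y f (x, y)).
Proof.
move=> mf.
rewrite (_ : (fun x => _) = fun x =>
    \int[P]_y f^\+ (x, y) - \int[P]_y f^\- (x, y)).
  apply: emeasurable_funB.
    apply: (@measurable_fun_fubini_tonelli_F _ _ T U R P f^\+) => //.
    exact: measurable_funepos.
  apply: (@measurable_fun_fubini_tonelli_F _ _ T U R P f^\-) => //.
  exact: measurable_funeneg.
apply/funext => x; rewrite [LHS]integralE.
by congr (_ - _); apply: eq_integral => y _; rewrite ?funeposE ?funenegE.
Qed.

Lemma ae_full d (T : measurableType d) (P : probability T R) (A : set T)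
    (f g : T -> \bar R) : measurable A -> P A = 1 ->
  (forall x, A x -> f x = g x) -> ae_eq P setT f g.
Proof.
move=> mA PA fg; exists (~` A); split; first exact: measurableC.
  by have := probability_setC P mA; rewrite PA subee.
by move=> t /= nE At; apply: nE => _; exact: fg.
Qed.

(** On the unit interval, [|x - y|] is half the distance of [1 - 2 x] and [1 -
    2 y], so the two kernels agree. *)
Lemma log_energyE (K : set R) (mu : probability (measurableTypeR R) R) :
  measurable K -> mu K = 1 -> (forall x, K x -> 0 <= x <= 1)%R ->
  log_energy mu = energy mu (fun x => 1 - 2 * x)%R.
Proof.
move=> mK muK K01.
have mX : measurable_fun [set: measurableTypeR R] (fun x : measurableTypeR R => 1 - 2 * x)%R.
  by apply: measurable_funB => //; exact: measurable_funM.
pose l (u : R) : \bar R := if (`|u| <= 0)%R then +oo else (- ln `|u|)%:E.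
have lE u : - lne `|u|%:E = l u by rewrite /l /=; case: ifP.
have ml : measurable_fun [set: R] l.
  apply: measurable_fun_ifT => //.
    by apply: measurable_fun_ler => //; exact: measurableT_comp.
  apply/measurable_EFinP; apply: measurableT_comp => //.
  by apply: measurableT_comp => //; exact: measurableT_comp.
rewrite energyE// /log_energy.
have ml2 : measurable_fun setT
    (fun z : measurableTypeR R * measurableTypeR R => l (z.1 - z.2)%R).
  by apply: (measurableT_comp ml); exact: measurable_funB.
have mk2 := measurable_logk_sub mX.
apply: ae_eq_integral => //.
- rewrite (_ : (fun x => _) = fun x => \int[mu]_y l (x - y)%R).
    exact: (measurable_partial_integral mu ml2).
  by apply/funext => x; apply: eq_integral => y _; rewrite lE.
- exact: (measurable_partial_integral mu mk2).
apply: (@ae_full _ (measurableTypeR R) mu K _ _ mK muK) => x Kx; apply: ae_eq_integral => //.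
- rewrite (_ : (fun y => _) = fun y => l (x - y)%R); last first.
    by apply/funext => y; rewrite lE.
  by apply: (measurableT_comp ml); exact: measurable_funB.
- apply: (measurableT_comp (@measurable_logk R)); exact: measurable_funB.
apply: (@ae_full _ (measurableTypeR R) mu K _ _ mK muK) => y Ky; rewrite lE /l /logk.
have /andP[x0 x1] := K01 x Kx; have /andP[y0 y1] := K01 y Ky.
have -> : (1 - 2 * x - (1 - 2 * y) = - (2 * (x - y)))%R by ring.
rewrite oppr_eq0 mulf_eq0 pnatr_eq0 /= normr_le0; case: ifPn => // u0.
rewrite normrN normrM (@gtr0_norm _ 2%R)// mulrC mulKf ?pnatr_eq0//.
congr EFin; apply/esym/max_idPr; rewrite oppr_ge0 ln_le0//.
by rewrite ler_norml; apply/andP; split; lra.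
Qed.

End LogEnergy.

Section EquilibriumDescent.
Local Open Scope ereal_scope.
Variables (R : realType) (gamma : nat -> R).
Hypothesis gamma_bnd : (forall k, (0 < k)%N -> 0 < gamma k < 1 / 4)%R.
Hypothesis gamma_sum : \sum_(1 <= k <oo) (2 ^- k * ln (1 / gamma k))%:E < +oo.

(** The parameters that remain after [i] steps: [cantor_set (level i)] carries
    the image of K under [gorbit gamma i]. *)
Definition level (i : nat) : nat -> R := fun k => gamma (i + k).+1.

Lemma level_admissible i : admissible (level i).
Proof. by move=> k; exact: gamma_bnd. Qed.

Lemma tail_level i : tail_seq (level i) = level i.+1.
Proof. by apply/funext => k; rewrite /tail_seq /level addSnnS. Qed.

Lemma qiter_level i k x :
  qiter (level i) k (gorbit gamma i x) = gorbit gamma (i + k) x.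
Proof.
elim: k => [|k IH]; first by rewrite addn0.
by rewrite addnS orbitS//= IH.
Qed.

Lemma gK_orbit x : gK gamma x <-> cantor_set (level 0) (gorbit gamma 0 x).
Proof.
split=> [h k|h [|k] _].
- rewrite qiter_level add0n; case: k => [|k].
    have := h 0%N I; rewrite /= in_itv /= ler_norml => /andP[x0 x1].
    by apply/andP; split; lra.
  by have := h k.+1 I; rewrite /= in_itv /= -ler_norml.
- have := h 0%N; rewrite /= in_itv /= ler_norml => /andP[x0 x1].
  by apply/andP; split; lra.
by have := h k.+1; rewrite qiter_level /= in_itv /= -ler_norml.
Qed.

Lemma gK01 x : gK gamma x -> (0 <= x <= 1)%R.
Proof. by move=> h; have := h 0%N I; rewrite /= in_itv. Qed.

Lemma orbit_cantor i x : gK gamma x -> cantor_set (level i) (gorbit gamma i x).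
Proof.
move=> /gK_orbit h k; rewrite qiter_level.
by have := h (i + k)%N; rewrite qiter_level add0n.
Qed.

Lemma measurable_orbit i : measurable_fun [set: R] (gorbit gamma i).
Proof.
rewrite (_ : gorbit gamma i = fun x => (gorbitp gamma i).[x])%R.
  by apply: continuous_measurable_fun; exact: continuous_horner.
by apply/funext => x; rewrite orbitpE.
Qed.

Lemma measurable_gK : measurable (gK gamma).
Proof.
rewrite (_ : gK gamma = gorbit gamma 0 @^-1` cantor_set (level 0)); last first.
  by apply/seteqP; split => x /gK_orbit.
rewrite -[X in measurable X]setTI; apply: measurable_orbit => //.
exact: measurable_cantor_set.
Qed.

Lemma level0_sum_bounded : exists C : R,
  forall n, (\sum_(k < n) 2 ^- k.+1 * - ln (level 0%N k) <= C)%R.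
Proof.
have t0 n : (0 < n)%N -> 0 <= (2 ^- n * ln (1 / gamma n))%:E.
  move=> n0; have /andP[g0 g1] := gamma_bnd n0.
  rewrite lee_fin mulr_ge0 ?invr_ge0 ?exprn_ge0// ln_ge0//.
  by rewrite ler_pdivlMr//; lra.
have S0 : 0 <= \sum_(1 <= k <oo) (2 ^- k * ln (1 / gamma k))%:E.
  by apply: nneseries_ge0 => n n1 _; exact: t0.
move: gamma_sum S0; case E : (\sum_(1 <= k <oo) _) => [C| |]// _ _.
exists C => n; rewrite -lee_fin -E.
apply: (@le_trans _ _ (\sum_(1 <= k < n.+1) (2 ^- k * ln (1 / gamma k))%:E)).
  rewrite sumEFin lee_fin big_add1 /= big_mkord le_eqVlt; apply/orP; left.
  apply/eqP; apply: eq_bigr => k _; rewrite /level add0n div1r lnV ?posrE//.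
  by have /andP[] := gamma_bnd (ltn0Sn k).
by apply: nneseries_lim_ge => k k1 _; exact: t0.
Qed.

Variable rho : probability (measurableTypeR R) R.
Hypothesis rho_eq : is_equilibrium_measure (gK gamma) rho.

Let rhoK : rho (gK gamma) = 1.
Proof. by case: rho_eq. Qed.

Let mo i : measurable_fun [set: measurableTypeR R] (gorbit gamma i : measurableTypeR R -> R).
Proof. exact: measurable_orbit. Qed.

(** The change of variable [z = 1 - 2 x] matches measures on [cantor_set
    (level 0)] with measures on K. *)
Lemma rho_minimal_level0 (nu : probability (measurableTypeR R) R) :
  nu (cantor_set (level 0)) = 1 -> energy rho (gorbit gamma 0) <= energy nu id.
Proof.
move=> nuK.
pose X : measurableTypeR R -> measurableTypeR R := fun z => ((1 - z) / 2)%R.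
have mX : measurable_fun setT X.
  by apply: measurable_funM => //; exact: measurable_funB.
pose mfX : {mfun measurableTypeR R >-> measurableTypeR R} :=
  HB.pack_for {mfun measurableTypeR R >-> measurableTypeR R} X
    (isMeasurableFun.Build _ _ (measurableTypeR R) (measurableTypeR R) X mX).
pose mu : probability (measurableTypeR R) R := distribution nu mfX.
have oX z : gorbit gamma 0 (X z) = z by rewrite /gorbit /X; field.
have muK : mu (gK gamma) = 1.
  rewrite -nuK /mu /distribution /pushforward; congr (nu _).
  apply/seteqP; split => z h; last by apply/(gK_orbit (X z)).2; rewrite oX.
  by have := (gK_orbit (X z)).1 h; rewrite oX.
have <- : log_energy rho = energy rho (gorbit gamma 0).
  exact: (log_energyE measurable_gK rhoK gK01).
have <- : energy mu (gorbit gamma 0) = energy nu id.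
  apply: (energy_law (mo 0)) => f mf f0.
  rewrite ge0_integral_distribution//; last exact: (measurableT_comp mf (mo 0)).
  by apply: eq_integral => z _; congr f; exact: oX.
have <- : log_energy mu = energy mu (gorbit gamma 0).
  exact: (log_energyE measurable_gK muK gK01).
by case: rho_eq => _; apply.
Qed.

Lemma symmetrized_full (P : probability (measurableTypeR R) R)
    (a : measurableTypeR R -> R) (ma : measurable_fun setT a) (A B : set R) :
  measurable A -> measurable B -> P A = 1 ->
  (forall x, A x -> B (a x) /\ B (- a x)%R) -> symmetrized P ma B = 1.
Proof.
move=> mA mB PA H.
have full (C : set (measurableTypeR R)) : measurable C -> (A `<=` C)%classic -> P C = 1.
  move=> mC AC; apply/eqP; rewrite eq_le; apply/andP; split.
    by apply: probability_le1.
  by rewrite -PA; apply: le_measure; rewrite ?inE.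
rewrite symmetrizedE// !full ?mule1 -?EFinD.
- by congr EFin; field.
- rewrite -[X in measurable X]setTI.
  have mNa : measurable_fun setT (fun x => - a x)%R by exact: measurableT_comp.
  exact: mNa.
- by move=> x /H[].
- by rewrite -[X in measurable X]setTI; exact: ma.
- by move=> x /H[].
Qed.

Lemma cantor_setN sigma (x : R) : cantor_set sigma x -> cantor_set sigma (- x)%R.
Proof.
by move=> /cantor_setP[h1 h2]; apply/cantor_setP; rewrite normrN quadN.
Qed.

Lemma cantor_set_branch i (y : R) : cantor_set (level i.+1) y ->
  cantor_set (level i) (branch (level i 0%N) y).
Proof.
move=> h; have hy : (`|y| <= 1)%R := h 0%N.
apply/cantor_setP; split.
  by rewrite ger0_norm ?branch_ge0// branch_le1//; exact: level_admissible.
by rewrite quad_branch ?tail_level//; exact: level_admissible.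
Qed.

(** Symmetrizing averages the energy with the mutual energy of the reflection;
    by minimality this does not decrease it. *)
Lemma energy_le_reflected i : energy rho (gorbit gamma i) < +oo ->
  (forall nu : probability (measurableTypeR R) R,
    nu (cantor_set (level i)) = 1 -> energy rho (gorbit gamma i) <= energy nu id) ->
  energy rho (gorbit gamma i) <= reflected_energy rho (gorbit gamma i).
Proof.
move=> Afin Amin.
have full : symmetrized rho (mo i) (cantor_set (level i)) = 1.
  apply: (@symmetrized_full rho _ (mo i) (gK gamma)) => //.
  - exact: measurable_gK.
  - exact: measurable_cantor_set.
  - by move=> x /(orbit_cantor i) h; split=> //; exact: cantor_setN.
have := Amin (symmetrized rho (mo i)) full.
have -> : energy (symmetrized rho (mo i)) id =
    (2^-1)%:E * energy rho (gorbit gamma i) + (2^-1)%:E * reflected_energy rho (gorbit gamma i).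
  exact: (energy_symmetrized rho (mo i)).
move: Afin (energy_ge0 rho (gorbit gamma i)) (reflected_energy_ge0 rho (gorbit gamma i)).
case: (energy _ _) => [a| |]// _; case: (reflected_energy _ _) => [b| |]// _ _.
- by rewrite -!EFinM -EFinD !lee_fin; lra.
- by rewrite leey.
Qed.

(** In the induction step the image of rho at level [i] is symmetric, so its
    energy is half of the energy at level [i + 1], minus half of [ln gamma]; a
    competitor at level [i + 1] lifts to a symmetric one at level [i] with the
    same relation. *)
Lemma rho_minimal i :
  energy rho (gorbit gamma i) < +oo /\
  forall nu : probability (measurableTypeR R) R,
    nu (cantor_set (level i)) = 1 -> energy rho (gorbit gamma i) <= energy nu id.
Proof.
have gi k : (0 < level k 0%N <= 1)%R.
  by have /andP[-> h] := level_admissible k 0%N; lra.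
elim: i => [|i [Afin Amin]].
  split; last exact: rho_minimal_level0.
  have [C hC] := level0_sum_bounded.
  have [nu [nuK nufin]] := cantor_set_finite_energy (level_admissible 0) hC.
  exact: le_lt_trans (rho_minimal_level0 nuK) nufin.
have AB := energy_le_reflected Afin Amin.
have o1 x : gK gamma x -> (`|gorbit gamma i x| <= 1)%R by move=> /(orbit_cantor i) /(_ 0%N).
have EA := reflected_energy_eq (mo i) measurable_gK rhoK o1 Afin AB.
have sum : energy rho (gorbit gamma i) + reflected_energy rho (gorbit gamma i) =
    energy rho (gorbit gamma i.+1) + (- ln (level i 0%N))%:E.
  apply: (energy_add_reflected (mo i) (mo i.+1) (gi i) measurable_gK rhoK) => x Kx.
  split; [exact: o1|exact: (orbit_cantor i.+1 Kx 0%N)|].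
  by rewrite orbitS// /level addn0.
rewrite EA in sum.
have lift (nu : probability (measurableTypeR R) R) : nu (cantor_set (level i.+1)) = 1 ->
    energy rho (gorbit gamma i) <= (2^-1)%:E * (energy nu id + (- ln (level i 0%N))%:E).
  move=> nuK.
  have mb : measurable_fun [set: measurableTypeR R]
    (branch (level i 0%N) : measurableTypeR R -> R) by exact: measurable_branch.
  have mid : measurable_fun [set: measurableTypeR R] (id : measurableTypeR R -> R).
    exact: measurable_id.
  have full : symmetrized nu mb (cantor_set (level i)) = 1.
    apply: (@symmetrized_full nu _ mb (cantor_set (level i.+1))) => //.
    - exact: measurable_cantor_set.
    - exact: measurable_cantor_set.
    - move=> y hy; have := cantor_set_branch hy.
      by move=> h; split=> //; exact: cantor_setN.
  apply: (le_trans (Amin (symmetrized nu mb) full)).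
  rewrite [leLHS](energy_symmetrized nu mb) -muleDr//; last first.
    by rewrite ge0_adde_def ?inE ?energy_ge0 ?reflected_energy_ge0.
  rewrite (energy_add_reflected mb mid (gi i) (measurable_cantor_set (level i.+1)) nuK)// => y hy.
  have hy1 : (`|y| <= 1)%R := hy 0%N.
  split=> //; last by rewrite quad_branch//; exact: level_admissible.
  by rewrite ger0_norm ?branch_ge0// branch_le1//; exact: level_admissible.
move: sum lift Afin (energy_ge0 rho (gorbit gamma i)).
case: (energy rho (gorbit gamma i)) => [a| |]// sum lift _ _.
move: sum (energy_ge0 rho (gorbit gamma i.+1)).
case: (energy rho (gorbit gamma i.+1)) => [e| |]// sum _.
split; first exact: ltry.
move=> nu /lift; move: (energy_ge0 nu id); case: (energy nu id) => [f| |]// _.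
  rewrite -EFinD -EFinM lee_fin lee_fin => h.
  have : (a + a = e + - ln (level i 0%N))%R by apply: EFin_inj; rewrite !EFinD.
  by lra.
by rewrite leey.
Qed.

Lemma orbit_odd_moment i (p : {poly R}) :
  mean rho (fun x => gorbit gamma i x * p.[gorbit gamma i x ^+ 2])%R = 0%R.
Proof.
have [Afin Amin] := rho_minimal i.
apply: (odd_moment_eq0 (mo i) measurable_gK rhoK) => //; last exact: energy_le_reflected.
by move=> x /(orbit_cantor i) /(_ 0%N).
Qed.

End EquilibriumDescent.

(** * The inner product of the equilibrium measure *)

Section EquilibriumFunctional.
Variables (R : realType) (rho : probability (measurableTypeR R) R) (K : set R).
Hypothesis mK : measurable K.
Hypothesis rhoK : rho K = 1%E.
Hypothesis K01 : forall x, K x -> 0 <= x <= 1.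

Definition functional (p : {poly R}) : R := mean rho (fun x => p.[x]).

Let clip (x : R) : R := Num.max 0 (Num.min 1 x).

Let clipE x : K x -> clip x = x.
Proof.
by move=> /K01/andP[x0 x1]; rewrite /clip (min_idPr x1) (max_idPr x0).
Qed.

Let clip01 x : 0 <= clip x <= 1.
Proof. by rewrite /clip le_max lexx ge_max ge_min lexx ler01. Qed.

Let bclip : bounded_measurable (clip : measurableTypeR R -> R).
Proof.
split; first by apply: measurable_maxr => //; exact: measurable_minr.
exists 1 => x; have /andP[c0 c1] := clip01 x.
by rewrite ger0_norm.
Qed.

Lemma measurable_horner (p : {poly R}) : measurable_fun [set: R] (fun x : R => p.[x]).
Proof. by apply: continuous_measurable_fun; exact: continuous_horner. Qed.

(** Truncation to the unit interval turns polynomials into bounded functions.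
    *)
Lemma horner_clip_ae (p : {poly R}) :
  ae_eq rho setT (fun x : measurableTypeR R => (p.[x])%:E) (fun x => (p.[clip x])%:E).
Proof. by apply: (@ae_full _ _ (measurableTypeR R) rho K _ _ mK rhoK) => x /clipE ->. Qed.

Lemma integrable_horner (p : {poly R}) :
  rho.-integrable setT (EFin \o (fun x : measurableTypeR R => p.[x])).
Proof.
have := bounded_measurable_integrable rho (bounded_measurable_horner p bclip).
move=> /integrableP[mc ic]; apply/integrableP; split.
  by apply/measurable_EFinP; exact: measurable_horner.
apply: le_lt_trans ic; rewrite le_eqVlt; apply/orP; left; apply/eqP.
apply: ge0_ae_eq_integral => //.
- by apply: measurableT_comp => //; apply/measurable_EFinP; exact: measurable_horner.
- exact: measurableT_comp.
by apply: (@ae_full _ _ (measurableTypeR R) rho K _ _ mK rhoK) => x /clipE /= ->.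
Qed.

Lemma functional_lin a p q : functional (a *: p + q) = a * functional p + functional q.
Proof.
rewrite /functional -meanZ ?integrable_horner// -meanD.
- by congr mean; apply/funext => x; rewrite hornerD hornerZ.
- rewrite (_ : (fun x : R => a * p.[x]) = (fun x : R => (a *: p).[x])).
    exact: integrable_horner.
  by apply/funext => x; rewrite hornerZ.
- exact: integrable_horner.
Qed.

Lemma functionalE p q :
  (\int[rho]_x (p.[x] * q.[x])%:E = (functional (p * q))%:E)%E.
Proof.
rewrite -meanE; last exact: integrable_horner.
by apply: eq_integral => x _; rewrite hornerM.
Qed.

Lemma monic_orthogonalP n P :
  is_monic_orthogonal rho n P <-> orthogonal_for functional n P.
Proof.
split=> -[mP sP oP]; split=> // q /oP; first by rewrite functionalE => -[].
by rewrite functionalE => ->.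
Qed.

Variable X : R -> R.
Hypothesis mX : measurable_fun setT (X : measurableTypeR R -> R).
Hypothesis EX : (energy rho X < +oo)%E.

(** The kernel is infinite on the diagonal, so a point mass would make the
    energy infinite. *)
Lemma finite_energy_atomless r : rho [set r] = 0%E.
Proof.
have [N [mN N0 subN]] := integrable_ae measurableT (integrable_logk_sub mX EX).
have m1 : measurable [set r] by exact: measurable_set1.
have : ((rho \x rho) ([set r] `*` [set r]) = 0)%E.
  apply/eqP; rewrite eq_le; apply/andP; split; last exact: measure_ge0.
  rewrite -N0; apply: le_measure; rewrite ?inE//; first exact: measurableX.
  move=> [x y] [/= -> ->]; apply: subN => /= h.
  by have := h I; rewrite subrr /logk eqxx.
have -> : ((rho \x rho) ([set r] `*` [set r]) = rho [set r] * rho [set r])%E.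
  exact: product_measure1E.
by move=> /eqP; rewrite mule_eq0 orbb => /eqP.
Qed.

Lemma finite_roots (p : {poly R}) : p != 0 ->
  exists s : seq R, forall x, root p x -> x \in s.
Proof.
have [n] := ubnP (size p); elim: n p => // n IH p; rewrite ltnS => sp p0.
case: (pselect (exists x, root p x)) => [[r pr]|nr]; last first.
  by exists [::] => x px; case: nr; exists x.
have [p' pE] := factor_theorem p r pr.
have p'0 : p' != 0 by apply: contra_neq p0 => p'0; rewrite pE p'0 mul0r.
have [|s sP] := IH p' _ p'0.
  by move: sp; rewrite pE size_mul ?polyXsubC_eq0// size_XsubC addn2.
exists (r :: s) => x; rewrite pE rootM root_XsubC inE => /orP[/sP ->|->//].
by rewrite orbT.
Qed.

Lemma negligible_finite (s : seq R) : rho.-negligible [set` s].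
Proof.
elim: s => [|r s IH].
  by rewrite set_nil; exact: negligible_set0.
have nr : rho.-negligible [set r].
  by exists [set r]; split=> //; exact: finite_energy_atomless.
apply: (negligibleS _ (negligibleU nr IH)) => x /=.
by rewrite inE => /orP[/eqP ->|xs]; [left|right].
Qed.

(** A nonnegative function with zero mean vanishes almost surely, but the
    zeros of [p] form a finite set, which has measure zero in the absence of
    atoms. *)
Lemma functional_pos p : p != 0 -> (forall x, 0 <= x <= 1 -> 0 <= p.[x]) ->
  0 < functional p.
Proof.
move=> p0 pge.
have fE : functional p = mean rho (fun x => p.[clip x]).
  rewrite /functional /mean; congr fine; apply: ae_eq_integral => //.
  - by apply/measurable_EFinP; exact: measurable_horner.
  - by apply/measurable_EFinP; exact: (bounded_measurable_horner p bclip).1.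
  - exact: horner_clip_ae.
have Ic := bounded_measurable_integrable rho (bounded_measurable_horner p bclip).
have c0 x : 0 <= p.[clip x] by apply: pge; exact: clip01.
have ge0 : 0 <= functional p.
  by rewrite fE /mean fine_ge0// integral_ge0// => x _; rewrite lee_fin.
rewrite lt_neqAle ge0 andbT; apply/negP => /eqP f0.
have i0 : (\int[rho]_x `|(p.[clip x])%:E| = 0)%E.
  transitivity (\int[rho]_x (p.[clip x])%:E)%E.
    by apply: eq_integral => x _; rewrite gee0_abs// lee_fin.
  by rewrite meanE// -fE -f0.
have mc : measurable_fun setT (fun x : measurableTypeR R => (p.[clip x])%:E).
  by apply/measurable_EFinP; exact: (bounded_measurable_horner p bclip).1.
have [N [mN N0 subN]] := (ae_eq_integral_abs rho measurableT mc).1 i0.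
have : rho K = 0%E.
  apply: measure_negligible => //.
  have [sr srP] := finite_roots p0.
  apply: (@negligibleS _ _ _ rho (N `|` [set` sr])).
    move=> x Kx; have [xs|xs] := boolP (x \in sr); first by right.
    left; apply: subN => /= h; have := h I; rewrite clipE// => -[px].
    by move/negP: xs; apply; apply: srP; apply/rootP.
  by apply: negligibleU; [exists N; split|exact: negligible_finite].
by rewrite rhoK => /eqP; rewrite onee_eq0.
Qed.

End EquilibriumFunctional.

(** * Spacing of the zeros *)

Theorem theorem4p6 (R : realType) (gamma : nat -> R)
    (gamma_bnd : forall k : nat, (0 < k)%N -> 0 < gamma k < 1 / 4)
    (gamma_sum :
      (\sum_(1 <= k <oo) (2 ^- k * ln (1 / gamma k))%:E < +oo)%E)
    (rho : probability (measurableTypeR R) R)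
    (rho_eq : is_equilibrium_measure (gK gamma) rho)
    (n : nat) (n_gt1 : (1 < n)%N)
    (s : nat) (s_def : (2 ^ (s - 1) <= n < 2 ^ s)%N) :
  (gdelta gamma (s + 2) <= Mgap n rho <= pi ^+ 2 / 4 * gdelta gamma (s - 2))
  /\
  (forall c : R, inf [set gamma k | k in [set k : nat | (0 < k)%N]] = c ->
     0 < c ->
     c ^+ 2 * gdelta gamma s <= Mgap n rho
       <= pi ^+ 2 / (4 * c ^+ 2) * gdelta gamma s).
Proof.
have mK := measurable_gK gamma_bnd.
have [rhoK _] := rho_eq.
have K01 : forall x, gK gamma x -> 0 <= x <= 1 by exact: gK01.
have [Efin _] := rho_minimal gamma_bnd gamma_sum rho_eq 0.
pose L := functional rho.
have Llin : forall a p q, L (a *: p + q) = a * L p + L q.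
  exact: (functional_lin mK rhoK K01).
have Lpos p : p != 0 -> (forall x, 0 <= x <= 1 -> 0 <= p.[x]) -> 0 < L p.
  exact: (functional_pos mK rhoK K01 (measurable_orbit gamma_bnd 0) Efin).
have Lodd i (b : {poly R}) : L (gorbitp gamma i * (b \Po gorbitp gamma i ^+ 2)) = 0.
  rewrite -[RHS](orbit_odd_moment gamma_bnd gamma_sum rho_eq i b) /L /functional.
  congr mean; apply/funext => x.
  by rewrite hornerM horner_comp horner_exp !orbitpE.
(* [P_(2^k)] is the monic multiple of [G_k]. *)
have Lorth := orbitp_orthogonal gamma_bnd Llin Lodd.
have [P oP] := orthogonal_for_exists Llin Lpos n.
(* The polynomial picked by [orthopoly] is characterized by orthogonality. *)
have oE : orthopoly n rho = P.
  have := @xgetPex _ 0 [set Q | is_monic_orthogonal rho n Q].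
  rewrite -/(orthopoly n rho) => H.
  have /(monic_orthogonalP mK rhoK K01) oQ : is_monic_orthogonal rho n (orthopoly n rho).
    by apply: H; exists P; apply/(monic_orthogonalP mK rhoK K01).
  exact: (orthogonal_for_unique Llin Lpos oQ oP).
have ZE x : Zset n rho x <-> root P x.
  by rewrite /Zset /= oE; split=> [h|/rootP//]; apply/rootP.
have l0 k : (lead_coef (gorbitp gamma k))^-1 != 0.
  by rewrite invr_eq0 lead_coef_eq0 -size_poly_gt0 size_orbitp.
have rootG k x : root ((lead_coef (gorbitp gamma k))^-1 *: gorbitp gamma k) x ->
    gorbit gamma k x = 0.
  rewrite rootZ ?l0// => /rootP; rewrite orbitpE//.
have Groot k x : gorbit gamma k x = 0 ->
    root ((lead_coef (gorbitp gamma k))^-1 *: gorbitp gamma k) x.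
  by move=> kx; rewrite rootZ ?l0//; apply/rootP; rewrite orbitpE.
have s2 : (2 <= s)%N.
  case: s s_def => [|[|s]]//; first by rewrite ltnS leqn0; lia.
  by rewrite expn1; lia.
case/andP: s_def => ns1 ns2.
pose D := [set d | exists x x' : R,
         [/\ Zset n rho x, Zset n rho x', x <> x' & d = `|x - x'|]].
have lbD : has_lbound D.
  by exists 0 => _ [x [x' [_ _ _ ->]]].
have lower : gdelta gamma (s + 2) <= Mgap n rho.
  apply: lb_le_inf.
    have [r [ur sr PE]] := orthogonal_for_roots Llin Lpos oP.
    case: r ur sr PE => [|x [|y r]] /=; try by move=> _ sr; move: n_gt1; rewrite -sr.
    rewrite inE negb_or => /andP[/andP[xy _] _] _ PE.
    exists `|x - y|, x, y; split=> //; last exact/eqP.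
      by apply/ZE; rewrite PE root_prod_XsubC inE eqxx.
    by apply/ZE; rewrite PE root_prod_XsubC !inE eqxx orbT.
  have sep x x' : root P x -> root P x' -> x < x' -> gdelta gamma (s + 2) <= x' - x.
    move=> Px Px' xx'.
    have [z [/rootG Gz zx]] := root_between Llin Lpos ns2 oP (Lorth s) Px Px' xx'.
    have ns3 : (n < 2 ^ s.+1)%N by rewrite expnS; lia.
    have [w [/rootG Gw wx]] := root_between Llin Lpos ns3 oP (Lorth s.+1) Px Px' xx'.
    by rewrite addn2; exact: (roots_separated gamma_bnd Gz Gw).
  move=> _ [x [x' [/ZE Px /ZE Px' /eqP xx' ->]]].
  move: xx'; rewrite neq_lt => /orP[xx'|xx'].
    by rewrite distrC gtr0_norm ?subr_gt0// sep.
  by rewrite gtr0_norm ?subr_gt0// sep.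
have upper : Mgap n rho <= pi ^+ 2 / 4 * gdelta gamma (s - 2).
  case: s s2 ns1 {ns2 lower} => [|[|k]]// _; rewrite !subSS !subn0 => nk.
  have [r1 [r2 [G1 G2 r10 r12 r2le]]] := leftmost_roots gamma_bnd k.
  apply: le_trans r2le.
  have mem x x' : root P x -> root P x' -> x < x' -> 0 <= x -> x' <= r2 -> Mgap n rho <= r2.
    move=> Px Px' xx' x0 x'r.
    apply: (@le_trans _ _ `|x - x'|).
      apply: ge_inf => //; exists x, x'; split=> //; try exact/ZE.
      by apply/eqP; rewrite lt_eqF.
    by rewrite distrC gtr0_norm ?subr_gt0//; lra.
  move: nk; rewrite leq_eqVlt => /orP[/eqP nE|nlt].
    have PE : P = (lead_coef (gorbitp gamma k.+1))^-1 *: gorbitp gamma k.+1.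
      by apply: (orthogonal_for_unique Llin Lpos oP); rewrite -nE.
    by apply: (mem r1 r2); rewrite // PE; exact: Groot.
  have [x [Px /andP[x1 x2]]] :=
    root_between Llin Lpos nlt (Lorth k.+1) oP (Groot _ _ G1) (Groot _ _ G2) r12.
  have [y [Py yr]] := root_below Llin Lpos nlt (Lorth k.+1) oP (Groot _ _ G1).
  (* [y < r1 < x < r2], and [y] is nonnegative. *)
  apply: (mem y x) => //; first exact: lt_trans yr x1.
    exact: (orthogonal_root_ge0 Lpos oP Py).
  exact: ltW.
split; first by rewrite lower upper.
move=> c cE c0.
have gc k : (0 < k)%N -> c <= gamma k.
  move=> k0; rewrite -cE; apply: ge_inf; last by exists k.
  by exists 0 => _ [j /= j0 <-]; have /andP[/ltW] := gamma_bnd j j0.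
have dpos := gdelta_gt0 gamma_bnd.
apply/andP; split.
  apply: le_trans lower; rewrite addn2 !gdeltaS -mulrA mulrC.
  have := gc s.+1 isT; have := gc s.+2 isT => h1 h2.
  by rewrite ler_pM2l// expr2 ler_pM// ltW.
apply: (le_trans upper).
case: s s2 {ns1 ns2 lower upper} => [|[|k]]// _; rewrite !subSS subn0 !gdeltaS.
have h1 := gc k.+1 isT; have h2 := gc k.+2 isT.
have cc : c ^+ 2 <= gamma k.+1 * gamma k.+2 by rewrite expr2 ler_pM// ltW.
have -> : pi ^+ 2 / (4 * c ^+ 2) * (gdelta gamma k * gamma k.+1 * gamma k.+2) =
    pi ^+ 2 / 4 * gdelta gamma k * (gamma k.+1 * gamma k.+2 / c ^+ 2).
  by field; rewrite gt_eqF.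
rewrite ler_peMr//.
  by rewrite mulr_ge0 ?(ltW (dpos k))// divr_ge0// sqr_ge0.
by rewrite ler_pdivlMr ?exprn_gt0// mul1r.
Qed.
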